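(* Let $\mathfrak g$ be a $\mathbb Z$-graded quadratic color Lie algebra with form $B$, and let $P_B\in\widehat S^2_\varepsilon(\mathfrak g^* )$ be the invariant quadratic polynomial induced by $B$. A Chern--Simons element for $P_B$ and the universal connection $A_{\mathrm{univ}}$ of the completed Weil algebra $\widehat W_\varepsilon(\mathfrak g)$ is $$\mathcal D=\sum_a e^a\otimes e_a+1\otimes\phi\in\widehat W_\varepsilon(\mathfrak g),$$ that is, $\mathrm{CS}_{P_B}(A_{\mathrm{univ}})=\mathcal D$: the element $\mathcal D$ is odd and $\mathrm d^W\mathcal D=P_B(F_{\mathrm{univ}})$.
   Context: Fix an abelian group $\Gamma$ (neutral element $0_\Gamma$) and a commutation factor $\varepsilon:\Gamma\times\Gamma\to\mathbb C^\times$ (multiplicative in each variable, $\varepsilon(\alpha,\beta)\varepsilon(\beta,\alpha)=1$); write $\varepsilon(x,y)=\varepsilon(|x|,|y|)$, $\varepsilon(x)=\varepsilon(x,x)$ for homogeneous elements. A color Lie algebra is a $\Gamma$-graded complex vector space with graded bracket, $[x,y]=-\varepsilon(x,y)[y,x]$, $[x,[y,z]]=[[x,y],z]+\varepsilon(x,y)[y,[x,z]]$. $\mathbb Z$-graded quadratic color Lie algebra: $\mathfrak g=\bigoplus_{i\in\mathbb Z}\mathfrak g_i$, each $\mathfrak g_i$ finite-dimensional and $\Gamma$-graded, $[\mathfrak g_i,\mathfrak g_j]\subseteq\mathfrak g_{i+j}$, with a nondegenerate, $\varepsilon$-symmetric ($B(x,y)=\varepsilon(x,y)B(y,x)$), invariant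 ($B([x,y],z)=B(x,[y,z])$) bilinear form $B$ with $B(x,y)=0$ unless $\deg x+\deg y=0$ and $|x|+|y|=0_\Gamma$. The restricted dual $\mathfrak g^*$ is identified with $\mathfrak g$ via $B$. Put $\mathfrak g_+=\bigoplus_{i>0}\mathfrak g_i$, $\mathfrak g_-=\bigoplus_{i\le0}\mathfrak g_i$. $(e_a)$ is a homogeneous basis of $\mathfrak g$, $(e^a)$ its dual basis, $B(e_a,e^b)=\delta_{ab}$. Weil algebra: $W_\varepsilon(\mathfrak g)=S_\varepsilon(\mathfrak g)\otimes\bigwedge_\varepsilon(\mathfrak g)$ with product $(a\otimes b)(c\otimes d)=\varepsilon(b,c)\,ac\otimes bd$, where $S_\varepsilon(\mathfrak g)$ is generated by $\mathfrak g$ with relations $xy=\varepsilon(x,y)yx$ and $\bigwedge_\varepsilon(\mathfrak g)$ by $\mathfrak g$ with relations $x\wedge y=-\varepsilon(x,y)\,y\wedge x$; parity $p$: $x\otimes1$ even, $1\otimes x$ odd. The completion $\widehat W_\varepsilon(\mathfrak g)$ is the direct sum over $(i,\gamma)\in\mathbb Z\times\Gamma$ of $\prod_{r\ge0}\bigoplus_{\alpha+\beta=\gamma}W_\varepsilon(\mathfrak g_-)_{(i-r,\alpha)}\otimes W_\varepsilon(\mathfrak g_+)_{(r,\beta)}$; $\widehat{\bigwedge}_\varepsilon(\mathfrak g)$, with its exterior powers $\widehat{\bigwedge}{}^k_\varepsilon(\mathfrak g)$, and $\widehat S_\varepsilon$ are defined likewise. Universal connection and curvature: $A_{\mathrm{univ}}(x)=1\otimes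 x$, $F_{\mathrm{univ}}(x)=x\otimes1$ for $x\in\mathfrak g$. For $\mathbb Z\times\Gamma$-homogeneous maps $A,A':\mathfrak g\to\widehat W_\varepsilon(\mathfrak g)$ put $$[A,A'](x)=-\tfrac12\sum_{a,b}\varepsilon(e_a)\varepsilon(e_b)\varepsilon(e_b,e_a)B(x,[e_a,e_b])\,A(e^a)A'(e^b).$$ The Weil differential $\mathrm d^W$ is the odd derivation of degree $(0,0_\Gamma)$ (so $\mathrm d^W(uv)=\mathrm d^W(u)v+(-1)^{p(u)}u\,\mathrm d^W(v)$) determined on generators by $\mathrm d^WA_{\mathrm{univ}}=F_{\mathrm{univ}}-\tfrac12[A_{\mathrm{univ}},A_{\mathrm{univ}}]$ and $\mathrm d^WF_{\mathrm{univ}}=-[A_{\mathrm{univ}},F_{\mathrm{univ}}]$. Chern--Simons element: the characteristic element of $P_B$ is $P_B(F_{\mathrm{univ}})=\sum_{a,b}B(e_a,e_b)\,F_{\mathrm{univ}}(e^a)F_{\mathrm{univ}}(e^b)$. A Chern--Simons element $\mathrm{CS}_{P_B}(A_{\mathrm{univ}})$ for $P_B$ and $A_{\mathrm{univ}}$ is an odd element of $\widehat W_\varepsilon(\mathfrak g)$ whose image under $\mathrm d^W$ is $P_B(F_{\mathrm{univ}})$ (in general not unique). Structure constants tensor: $\phi$ is the unique element of $\widehat{\bigwedge}{}^3_\varepsilon(\mathfrak g)$ of bidegree $(0,0_\Gamma)$ with $\langle\phi,x\wedge y\wedge z\rangle_\wedge=-\tfrac12B([x,y],z)$ for all homogeneous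 $x,y,z\in\mathfrak g$. Here $\langle\cdot,\cdot\rangle_\wedge$ is the (componentwise extended) bilinear form induced by $$\langle x_1\wedge\cdots\wedge x_k,\,y_1\wedge\cdots\wedge y_k\rangle_\wedge=\sum_{\sigma\in S_k}p(\sigma;x_1,\dots,x_k)\prod_{i=0}^{k-1}B(x_{\sigma(k-i)},y_{1+i}),$$ $p(\sigma;x_1,\dots,x_k)=\operatorname{sgn}(\sigma)\prod_{i<j,\ \sigma^{-1}(i)>\sigma^{-1}(j)}\varepsilon(x_i,x_j)$.
   Formalization: P_B(F_univ) is taken with the extra sign ε(e_a)ε(e_b)ε(e_b,e_a) in each term B(e_a,e_b)F(e^a)F(e^b); without it the claim fails once some ε(x,x) = −1 occurs (e.g. g odd abelian of dimension 2), and the two agree if all ε(x,x) = 1. *)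

(* Defs.v *)
From HB Require Import structures.
From mathcomp Require Import all_boot all_order all_algebra all_fingroup.
From mathcomp Require Import boolp classical_sets functions cardinality fsbigop.
From mathcomp Require Import reals complex.
From mathcomp Require Import monalg.
Set Implicit Arguments.
Unset Strict Implicit.
Unset Printing Implicit Defensive.
Import Order.TTheory GRing.Theory Num.Theory.
Local Open Scope ring_scope.
Local Open Scope quotient_scope.

Notation freeAlg K X := {malg K[{fmonom X}]}.

(** * Algebras presented by generators and relations *)

Section PresentedAlgebra.
Variables (K : comNzRingType) (X : choiceType) (rel : freeAlg K X -> Prop).

Inductive ideal_of : freeAlg K X -> Prop :=
| ideal_of0 : ideal_of 0
| ideal_ofD a r b p : rel r -> ideal_of p -> ideal_of (a * r * b + p).

Definition ideal_pred : {pred freeAlg K X} := fun p => `[< ideal_of p >].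

Lemma ideal_ofB p q : ideal_of p -> ideal_of q -> ideal_of (p - q).
Proof.
move=> Ip Iq; elim: Ip => [|a r b p' relr _ IHp]; last first.
  by rewrite -addrA; apply: ideal_ofD.
rewrite sub0r; elim: Iq => [|a r b q' relr _ IHq].
  by rewrite oppr0; apply: ideal_of0.
by rewrite opprD -mulNr -mulNr; apply: ideal_ofD.
Qed.

Lemma ideal_pred_zmod : zmod_closed ideal_pred.
Proof.
split=> [|p q /asboolP Ip /asboolP Iq]; apply/asboolP; first exact: ideal_of0.
exact: ideal_ofB.
Qed.

HB.instance Definition _ := GRing.isZmodClosed.Build _ ideal_pred
  ideal_pred_zmod.

Lemma ideal_ofMl c p : ideal_of p -> ideal_of (c * p).
Proof.
elim=> [|a r b q relr _ IHq]; first by rewrite mulr0; apply: ideal_of0.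
by rewrite mulrDr !mulrA; apply: ideal_ofD.
Qed.

Lemma ideal_ofMr c p : ideal_of p -> ideal_of (p * c).
Proof.
elim=> [|a r b q relr _ IHq]; first by rewrite mul0r; apply: ideal_of0.
by rewrite mulrDl -mulrA; apply: ideal_ofD.
Qed.

Definition presAlg := Quotient.quot ideal_pred.

HB.instance Definition _ := GRing.Zmodule.on presAlg.

Lemma presAlg_eqP (p q : freeAlg K X) :
  reflect (\pi_presAlg p = \pi_presAlg q) `[< ideal_of (p - q) >].
Proof.
have := Quotient.idealrBE ideal_pred p q; rewrite unfold_in /= => ->.
exact: eqP.
Qed.

Lemma presAlg_eq (p q : freeAlg K X) :
  ideal_of (p - q) -> \pi_presAlg p = \pi_presAlg q.
Proof. by move=> /asboolP/presAlg_eqP. Qed.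

Lemma repr_presAlg (p : freeAlg K X) :
  ideal_of (generic_quotient.repr (\pi_presAlg p) - p).
Proof. by apply/asboolP/presAlg_eqP; rewrite reprK. Qed.

Definition presAlg_one : presAlg := \pi_presAlg 1.
Definition presAlg_mul (x y : presAlg) : presAlg :=
  \pi_presAlg (generic_quotient.repr x * generic_quotient.repr y).
Definition presAlg_scale (c : K) (x : presAlg) : presAlg :=
  \pi_presAlg (c *: generic_quotient.repr x).

Lemma pi_presAlgM p q :
  presAlg_mul (\pi_presAlg p) (\pi_presAlg q) = \pi_presAlg (p * q).
Proof.
apply: presAlg_eq.
set p' := generic_quotient.repr _; set q' := generic_quotient.repr _.
have -> : p' * q' - p * q = (p' - p) * q' - (p * (q - q')).
  by rewrite mulrBl mulrBr opprB addrA subrK.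
apply: ideal_ofB; first by apply/ideal_ofMr/repr_presAlg.
apply: ideal_ofMl; rewrite -opprB -sub0r; apply: ideal_ofB (ideal_of0) _.
exact: repr_presAlg.
Qed.

Lemma pi_presAlgZ c p :
  presAlg_scale c (\pi_presAlg p) = \pi_presAlg (c *: p).
Proof.
apply: presAlg_eq; rewrite -scalerBr -[_ - _]mul1r scalerAl.
exact/ideal_ofMl/repr_presAlg.
Qed.

Lemma pi_presAlgD (p q : freeAlg K X) :
  \pi_presAlg p + \pi_presAlg q = \pi_presAlg (p + q).
Proof. exact/esym/Quotient.pi_add. Qed.

Lemma presAlgW (P : presAlg -> Prop) :
  (forall p : freeAlg K X, P (\pi_presAlg p)) -> forall x, P x.
Proof. by move=> Ppi x; rewrite -[x]reprK; apply: Ppi. Qed.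

Lemma presAlg_mulA : associative presAlg_mul.
Proof.
elim/presAlgW=> p; elim/presAlgW=> q; elim/presAlgW=> r.
by rewrite (pi_presAlgM q) (pi_presAlgM p) (pi_presAlgM p) pi_presAlgM mulrA.
Qed.

Lemma presAlg_mul1 : left_id presAlg_one presAlg_mul.
Proof. by elim/presAlgW=> p; rewrite (pi_presAlgM 1 p) mul1r. Qed.

Lemma presAlg_mulr1 : right_id presAlg_one presAlg_mul.
Proof. by elim/presAlgW=> p; rewrite (pi_presAlgM p 1) mulr1. Qed.

Lemma presAlg_mulDl : left_distributive presAlg_mul +%R.
Proof.
elim/presAlgW=> p; elim/presAlgW=> q; elim/presAlgW=> r.
by rewrite pi_presAlgD !pi_presAlgM pi_presAlgD mulrDl.
Qed.

Lemma presAlg_mulDr : right_distributive presAlg_mul +%R.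
Proof.
elim/presAlgW=> p; elim/presAlgW=> q; elim/presAlgW=> r.
by rewrite pi_presAlgD !pi_presAlgM pi_presAlgD mulrDr.
Qed.

Lemma presAlg_scaleA a b x :
  presAlg_scale a (presAlg_scale b x) = presAlg_scale (a * b) x.
Proof.
elim/presAlgW: x => p.
by rewrite (pi_presAlgZ b p) (pi_presAlgZ a (b *: p)) pi_presAlgZ scalerA.
Qed.

Lemma presAlg_scale1 : left_id 1 presAlg_scale.
Proof. by elim/presAlgW=> p; rewrite pi_presAlgZ scale1r. Qed.

Lemma presAlg_scaleDr : right_distributive presAlg_scale +%R.
Proof.
move=> c; elim/presAlgW=> p; elim/presAlgW=> q.
by rewrite pi_presAlgD !pi_presAlgZ pi_presAlgD scalerDr.
Qed.

Lemma presAlg_scaleDl x : {morph presAlg_scale^~ x : a b / a + b}.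
Proof.
by elim/presAlgW: x => p a b; rewrite /= !pi_presAlgZ pi_presAlgD scalerDl.
Qed.

HB.instance Definition _ := GRing.Zmodule_isPzRing.Build presAlg
  presAlg_mulA presAlg_mul1 presAlg_mulr1 presAlg_mulDl presAlg_mulDr.

HB.instance Definition _ := GRing.Zmodule_isLmodule.Build K presAlg
  presAlg_scaleA presAlg_scale1 presAlg_scaleDr presAlg_scaleDl.

Definition free_gen (x : X) : freeAlg K X := << fmu x >>.
Definition gen (x : X) : presAlg := \pi_presAlg (free_gen x).

End PresentedAlgebra.

Inductive span (K : pzRingType) (V : lmodType K) (P : V -> Prop) : V -> Prop :=
| span0 : span P 0
| spanD c u v : P u -> span P v -> span P (c *: u + v).

(** * Quadratic color Lie algebras *)

Record commutation_factor (R : realType) (Gam : zmodType)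
    (eps : Gam -> Gam -> R[i]) : Prop := {
  cf_Dl : forall a b c, eps (a + b) c = eps a c * eps b c;
  cf_Dr : forall a b c, eps a (b + c) = eps a b * eps a c;
  cf_skew : forall a b, eps a b * eps b a = 1
}.

(* The direct sum decomposition by (int * Gam) is encoded by its family of
   projections: x is homogeneous of degree d iff qc_pr d x = x. *)
Record quadColorLie (R : realType) (Gam : zmodType)
    (eps : Gam -> Gam -> R[i]) := QuadColorLie {
  qc_space :> lmodType R[i];
  qc_pr : int * Gam -> qc_space -> qc_space;
  qc_br : qc_space -> qc_space -> qc_space;
  qc_form : qc_space -> qc_space -> R[i];
  qc_pr_linear : forall d, linear (qc_pr d);
  qc_pr_pr : forall d d' x,
    qc_pr d (qc_pr d' x) = if d == d' then qc_pr d x else 0;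
  qc_pr_sum : forall x,
    exists2 s : seq (int * Gam), uniq s & x = \sum_(d <- s) qc_pr d x;
  qc_fin_dim : forall i : int, exists s : seq qc_space, forall x,
    (forall d, d.1 != i -> qc_pr d x = 0) ->
    exists c : qc_space -> R[i], x = \sum_(y <- s) c y *: y;
  qc_br_linearl : forall y, linear (qc_br^~ y);
  qc_br_linearr : forall x, linear (qc_br x);
  qc_br_graded : forall d d' x y, qc_pr d x = x -> qc_pr d' y = y ->
    qc_pr (d + d') (qc_br x y) = qc_br x y;
  qc_br_skew : forall d d' x y, qc_pr d x = x -> qc_pr d' y = y ->
    qc_br x y = - (eps d.2 d'.2 *: qc_br y x);
  qc_br_jacobi : forall d d' x y z, qc_pr d x = x -> qc_pr d' y = y ->
    qc_br x (qc_br y z) =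
      qc_br (qc_br x y) z + eps d.2 d'.2 *: qc_br y (qc_br x z);
  qc_form_linearl : forall y, scalar (qc_form^~ y);
  qc_form_linearr : forall x, scalar (qc_form x);
  qc_form_graded : forall d d' x y, qc_pr d x = x -> qc_pr d' y = y ->
    d + d' != 0 -> qc_form x y = 0;
  qc_form_sym : forall d d' x y, qc_pr d x = x -> qc_pr d' y = y ->
    qc_form x y = eps d.2 d'.2 * qc_form y x;
  qc_form_inv : forall x y z, qc_form (qc_br x y) z = qc_form x (qc_br y z);
  qc_form_nondeg : forall x, (forall y, qc_form x y = 0) -> x = 0
}.

Section WeilAlgebra.
Variables (R : realType) (Gam : zmodType) (eps : Gam -> Gam -> R[i]).
Variable g : quadColorLie eps.

Local Notation C := (R[i]).
Local Notation deg := (int * Gam)%type.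
Local Notation pr := (@qc_pr R Gam eps g).
Local Notation "[[ x , y ]]" := (@qc_br R Gam eps g x y).
Local Notation B := (@qc_form R Gam eps g).

Definition homog (d : deg) (x : g) : Prop := pr d x = x.

(* The dual vectors [hb_dual] are determined by the last condition and are
   automatically homogeneous, of degree opposite to [hb_deg]. *)
Record homogBasis := HomogBasis {
  hb_idx : choiceType;
  hb_vec : hb_idx -> g;
  hb_deg : hb_idx -> deg;
  hb_dual : hb_idx -> g;
  hb_homog : forall a, homog (hb_deg a) (hb_vec a);
  hb_free : forall (s : seq hb_idx) (c : hb_idx -> C), uniq s ->
    \sum_(a <- s) c a *: hb_vec a = 0 -> forall a, a \in s -> c a = 0;
  hb_span : forall x, exists (s : seq hb_idx) (c : hb_idx -> C),
    x = \sum_(a <- s) c a *: hb_vec a;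
  hb_dualP : forall a b, B (hb_vec a) (hb_dual b) = (a == b)%:R
}.

(** ** The color symmetric and exterior algebras *)

(* xy = s eps(x,y) yx, with s = 1 (symmetric) or s = -1 (exterior). *)
Inductive color_rel (s : C) : freeAlg C g -> Prop :=
| color_rel_lin c x y : color_rel s
    (free_gen C (c *: x + y) - (c *: free_gen C x + free_gen C y))
| color_rel_comm d d' x y : homog d x -> homog d' y -> color_rel s
    (free_gen C x * free_gen C y
     - (s * eps d.2 d'.2) *: (free_gen C y * free_gen C x)).

Definition colorAlg (s : C) := presAlg (color_rel s).
Definition colorSym := colorAlg 1.
Definition colorExt := colorAlg (-1).
HB.instance Definition _ s := GRing.PzRing.on (colorAlg s).
HB.instance Definition _ s := GRing.Lmodule.on (colorAlg s).
HB.instance Definition _ := GRing.PzRing.on colorSym.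
HB.instance Definition _ := GRing.Lmodule.on colorSym.
HB.instance Definition _ := GRing.PzRing.on colorExt.
HB.instance Definition _ := GRing.Lmodule.on colorExt.

Definition cgen (s : C) (x : g) : colorAlg s := gen (color_rel s) x.
Definition sym_gen (x : g) : colorSym := cgen 1 x.
Definition ext_gen (x : g) : colorExt := cgen (-1) x.

(* Products of k homogeneous generators with Z-degrees in Q, of total degree
   d. *)
Inductive word (s : C) (Q : pred int) : nat -> deg -> colorAlg s -> Prop :=
| word0 : word Q 0 0 1
| wordS d x k d' u : Q d.1 -> homog d x -> word Q k d' u ->
    word Q k.+1 (d + d') (cgen s x * u).

(* Degree d part of the k-th power: of the subalgebra generated by g_- for
   [Q = nonpos], by g_+ for [Q = pos], of the whole algebra for [Q = xpredT]. *)
Definition piece (s : C) (Q : pred int) (k : nat) (d : deg) :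
  colorAlg s -> Prop := span (@word s Q k d).

Definition nonpos : pred int := fun i => i <= 0.
Definition pos : pred int := fun i => 0 < i.

(** ** The Weil algebra *)

(* The tensor product of colorSym and colorExt with its twisted product,
   presented by the symbols a (x) b subject to bilinearity, 1 (x) 1 = 1 and the
   product rule.  By the product rule the pure tensors span linearly, so this
   is the twisted product carried by the vector space tensor product. *)
Local Notation ftens a b := (free_gen C ((a, b) : (colorSym * colorExt)%type)).

Inductive weil_rel : freeAlg C (colorSym * colorExt)%type -> Prop :=
| weil_rel_linl c a a' b :
    weil_rel (ftens (c *: a + a') b - (c *: ftens a b + ftens a' b))
| weil_rel_linr c a b b' :
    weil_rel (ftens a (c *: b + b') - (c *: ftens a b + ftens a b'))
| weil_rel_one : weil_rel (ftens 1 1 - 1)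
| weil_rel_mul k d l d' (a a' : colorSym) (b b' : colorExt) :
    @piece (-1) xpredT k d b -> @piece 1 xpredT l d' a' ->
    weil_rel (ftens a b * ftens a' b'
              - eps d.2 d'.2 *: ftens (a * a') (b * b')).

Definition Weil := presAlg weil_rel.
HB.instance Definition _ := GRing.PzRing.on Weil.
HB.instance Definition _ := GRing.Lmodule.on Weil.

Definition tens (a : colorSym) (b : colorExt) : Weil := gen weil_rel (a, b).

Definition weil_piece (Q : pred int) (d : deg) : Weil -> Prop :=
  span (fun w => exists k l d1 d2 (a : colorSym) (b : colorExt),
    [/\ @piece 1 Q k d1 a, @piece (-1) Q l d2 b, d1 + d2 = d & w = tens a b]).

Definition weil_parity (p : bool) : Weil -> Prop :=
  span (fun w => exists k d (a : colorSym) (b : colorExt),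
    [/\ @piece (-1) xpredT k d b, odd k = p & w = tens a b]).

(** ** Completions *)

(* W(g_-) (x) W(g_+) is identified with W(g) through multiplication:
   [weil_cpiece (i, gamma) r] is the sum over alpha + beta = gamma of the
   W(g_-)_(i - r, alpha) (x) W(g_+)_(r, beta).  These subspaces grade the
   algebra W(g), so that an element of the completion amounts to the sequence
   of its components in r : nat, and the product is the Cauchy product. *)
Definition weil_cpiece (d : deg) (r : nat) : Weil -> Prop :=
  span (fun w => exists d1 d2 (u v : Weil),
    [/\ weil_piece nonpos d1 u, weil_piece pos d2 v,
        d1 + d2 = d, d2.1 = r & w = u * v]).

Definition weil_seq := nat -> Weil.
HB.instance Definition _ := GRing.Lmodule.on weil_seq.

Definition in_deg (d : deg) (u : weil_seq) : Prop :=
  forall r, weil_cpiece d r (u r).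

Definition in_What (u : weil_seq) : Prop :=
  exists (s : seq deg) (v : deg -> weil_seq),
    (forall d, in_deg d (v d)) /\ u = \sum_(d <- s) v d.

Definition has_parity (p : bool) (u : weil_seq) : Prop :=
  forall r, weil_parity p (u r).

Definition cmul (u v : weil_seq) : weil_seq :=
  fun r => \sum_(k < r.+1) u k * v (r - k)%N.

(* Sums of families that are locally finite, i.e. with finitely many nonzero
   terms for each r. *)
Definition csum (J : choiceType) (f : J -> weil_seq) : weil_seq :=
  fun r => \sum_(j \in [set: J]%classic) f j r.

(* The r-component of an element of g: generators of degree i > 0 lie in
   r = i, those of degree i <= 0 in r = 0. *)
Definition cpart (r : nat) (x : g) : g :=
  \sum_(d \in [set d : deg | absz (Num.max d.1 0) = r]%classic) pr d x.

Definition Auniv (x : g) : weil_seq := fun r => tens 1 (ext_gen (cpart r x)).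
Definition Funiv (x : g) : weil_seq := fun r => tens (sym_gen (cpart r x)) 1.
Definition tens_gen (x y : g) : weil_seq := fun r =>
  \sum_(k < r.+1) tens (sym_gen (cpart k x)) (ext_gen (cpart (r - k)%N y)).

Definition ext_cpiece (k : nat) (d : deg) (r : nat) : colorExt -> Prop :=
  span (fun w => exists k1 k2 d1 d2 (u v : colorExt),
    [/\ @piece (-1) nonpos k1 d1 u, @piece (-1) pos k2 d2 v,
        (k1 + k2 = k)%N, d1 + d2 = d & d2.1 = r /\ w = u * v]).

(** ** The Weil differential *)

Section Basis.
Variable e : homogBasis.
Local Notation ed a := (hb_deg (h := e) a).2.
Local Notation I2 := (hb_idx e * hb_idx e)%type.

Definition dual_sign (a b : hb_idx e) : C :=
  eps (ed a) (ed a) * eps (ed b) (ed b) * eps (ed b) (ed a).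

Definition conn_bracket (A A' : g -> weil_seq) (x : g) : weil_seq :=
  - (2^-1 *: csum (fun p : I2 =>
      (dual_sign p.1 p.2 * B x [[hb_vec p.1, hb_vec p.2]])
        *: cmul (A (hb_dual p.1)) (A' (hb_dual p.2)))).

Record weil_differential (D : weil_seq -> weil_seq) : Prop := {
  wd_linear : forall c u v, in_What u -> in_What v ->
    D (c *: u + v) = c *: D u + D v;
  wd_degree : forall d u, in_deg d u -> in_deg d (D u);
  wd_odd : forall p u, in_What u -> has_parity p u -> has_parity (~~ p) (D u);
  wd_leibniz : forall p u v, in_What u -> in_What v -> has_parity p u ->
    D (cmul u v) = cmul (D u) v + (-1) ^+ p *: cmul u (D v);
  (* Continuity, for the product topology on each homogeneous component: it is
     what makes D determined by its values on the generators. *)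
  wd_continuous : forall d r, exists N, forall u, in_deg d u ->
    (forall n, (n < N)%N -> u n = 0) ->
    forall n, (n <= r)%N -> D u n = 0;
  wd_A : forall x,
    D (Auniv x) = Funiv x - 2^-1 *: conn_bracket Auniv Auniv x;
  wd_F : forall x, D (Funiv x) = - conn_bracket Auniv Funiv x
}.

(* The sign [dual_sign a b] is the one with which [conn_bracket] evaluates a
   bilinear map on a pair of g-valued elements.  On the nonzero terms it is
   eps (ed a) (ed a) and the summand is B e_b e_a . F(e^a) F(e^b); in
   particular the sign is 1 there if eps d d = 1 for all d.  In general it
   cannot be dropped: if g is odd and abelian with basis e1, e2 and
   B e1 e2 = 1, the unsigned sum is 2 F(e1) F(e2), while the differential of
   sum_a e^a (x) e_a is - 2 F(e1) F(e2). *)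
Definition char_form : weil_seq :=
  csum (fun p : I2 => (dual_sign p.1 p.2 * B (hb_vec p.1) (hb_vec p.2))
    *: cmul (Funiv (hb_dual p.1)) (Funiv (hb_dual p.2))).

Definition cubic_dirac (phi : nat -> colorExt) : weil_seq :=
  csum (fun a : hb_idx e => tens_gen (hb_dual a) (hb_vec a))
  + (fun r => tens 1 (phi r)).

End Basis.

Definition chern_simons (D : weil_seq -> weil_seq) (P cs : weil_seq) : Prop :=
  [/\ in_What cs, has_parity true cs & D cs = P].

(** ** The structure constants tensor *)

Definition perm_sign k (sigma : 'S_k) (d : 'I_k -> deg) : C :=
  (-1) ^+ sigma *
  \prod_(p : 'I_k * 'I_k | (p.1 < p.2)%N
           && ((sigma^-1)%g p.2 < (sigma^-1)%g p.1)%N)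
    eps (d p.1).2 (d p.2).2.

(* The form is determined by these conditions; distinct exterior powers are
   orthogonal. *)
Record wedge_form (W : colorExt -> colorExt -> C) : Prop := {
  wf_linearl : forall v, scalar (W^~ v);
  wf_linearr : forall u, scalar (W u);
  wf_ortho : forall k l d d' (u v : colorExt), k != l ->
    @piece (-1) xpredT k d u -> @piece (-1) xpredT l d' v -> W u v = 0;
  wf_words : forall k (x y : 'I_k -> g) (d d' : 'I_k -> deg),
    (forall i, homog (d i) (x i)) -> (forall i, homog (d' i) (y i)) ->
    W (\prod_(i < k) ext_gen (x i)) (\prod_(i < k) ext_gen (y i)) =
    \sum_(sigma : 'S_k)
      perm_sign sigma d * \prod_(i < k) B (x (sigma (rev_ord i))) (y i)
}.

Definition structure_tensor (W : colorExt -> colorExt -> C)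
    (phi : nat -> colorExt) : Prop :=
  (forall r, ext_cpiece 3 0 r (phi r)) /\
  forall dx dy dz (x y z : g), homog dx x -> homog dy y -> homog dz z ->
    \sum_(r \in [set: nat]%classic)
      W (phi r) (ext_gen x * ext_gen y * ext_gen z)
    = - (2^-1 * B [[x, y]] z).

End WeilAlgebra.

(* Main.v *)
(* The identity is checked on each component r of the completion.  By continuity
   of dW, component r of dW(D) only depends on the part of D built from basis
   vectors of Z-degree at most M in absolute value, for M large: a finite sum.
   The pairing with triple products determines phi, which is
     phi = 1/12 sum_abc s(b,c) B(e_a, [e_b, e_c]) e^a e^b e^c
   with s(b,c) = dual_sign b c.  Write A and F for the images of the universal
   connection and curvature.  By the Leibniz rule, dW(D) is a sum of
   - terms F F, which add up to P_B(F);
   - terms F A A, multiples of sum s(b,c) B(e_a, [e_b, e_c]) F(e^a) A(e^b) A(e^c)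
     with coefficients -1/2 from dW(F) A, 1/4 from F dW(A) and 1/4 from dW(phi),
     the last one because the three factors of phi contribute equally;
   - terms A A A A from dW(phi) only, which cancel by the Jacobi identity. *)
From HB Require Import structures.
From mathcomp Require Import all_boot all_order all_algebra all_fingroup.
From mathcomp Require Import boolp classical_sets functions cardinality fsbigop.
From mathcomp Require Import reals complex.
From mathcomp Require Import monalg.
From mathcomp Require Import ring zify.
Require Import Defs.
Set Implicit Arguments.
Unset Strict Implicit.
Unset Printing Implicit Defensive.
Import Order.TTheory GRing.Theory Num.Theory.
Local Open Scope ring_scope.
Local Open Scope quotient_scope.

(** Two obstacles shape the proof. The sums over the basis are infinite, and a cut-off must lose
    nothing when an index is contracted. It is taken by absolute Z-degree because [B] pairs opposite
    degrees: a contraction over the range is then either complete or zero, and fixing the component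
    r together with total degree 0 keeps the contracted degrees in the range. The second obstacle is
    signs: B(e^a, e_a) = eps(e_a, e_a), so a basis and its dual are not freely exchanged. The factor
    [dual_sign] is what makes the coefficients transform under permutations of the indices inversely
    to the words in the e^a, so that renamed terms can be compared.

    Constants: 1/12 is the 1/2 of the defining pairing divided by the 6 permutations. The bracket
    carries -1/2, so the plain sums enter dW(F) with 1/2 and dW(A) with 1/4. The 1/2 becomes -1/2
    since sorting dW(F) A into the order F A A exchanges two odd letters. Finally 3 times 1/12 is
    1/4. *)

(** * Scalars in presented algebras, and reduction to spanning sets *)

Section PresentedAlgebraTheory.
Variables (K : comNzRingType) (X : choiceType) (rel : freeAlg K X -> Prop).

Lemma presAlg_scaleAl (c : K) (x y : presAlg rel) : c *: (x * y) = (c *: x) * y.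
Proof.
elim/presAlgW: x => p; elim/presAlgW: y => q.
rewrite /GRing.scale /GRing.mul /= (pi_presAlgZ _ c p) !pi_presAlgM.
by rewrite (pi_presAlgZ _ c (p * q)) scalerAl.
Qed.

(** Scalars are central in the free algebra: a constant sits on the unit monomial, which is neutral
    on both sides, and [K] is commutative. *)
Lemma presAlg_scaleAr (c : K) (x y : presAlg rel) : c *: (x * y) = x * (c *: y).
Proof.
have malg_scaleAr (p q : freeAlg K X) : c *: (p * q) = p * (c *: q).
  rewrite -[c *: (p * q)]mul_malgC -[c *: q]mul_malgC mulrA.
  suff -> : c%:MP * p = p * c%:MP by rewrite mulrA.
  rewrite !malgM_def fgmulUg fgmulgU.
  by apply: eq_bigr => k _; rewrite mul1m mulm1 mulrC.
elim/presAlgW: x => p; elim/presAlgW: y => q.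
rewrite /GRing.scale /GRing.mul /= (pi_presAlgZ _ c q) !pi_presAlgM.
by rewrite (pi_presAlgZ _ c (p * q)) malg_scaleAr.
Qed.

Lemma presAlg_rel (p q : freeAlg K X) :
  rel (p - q) -> \pi_(presAlg rel) p = \pi_(presAlg rel) q.
Proof.
move=> relpq; apply: presAlg_eq.
rewrite -[p - q]mulr1 -[(p - q) * 1]mul1r -[1 * _]addr0 mulrA.
exact: ideal_ofD (ideal_of0 _).
Qed.

Lemma gen_comm (c : K) (x y : X) :
  rel (free_gen K x * free_gen K y - c *: (free_gen K y * free_gen K x)) ->
  gen rel x * gen rel y = c *: (gen rel y * gen rel x).
Proof.
move=> /presAlg_rel E; rewrite /gen.
move: (free_gen K x) (free_gen K y) E => p q E.
by rewrite [LHS]pi_presAlgM [X in c *: X]pi_presAlgM [RHS]pi_presAlgZ.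
Qed.
End PresentedAlgebraTheory.

Section Span.
Variables (K : pzRingType) (V : lmodType K).

Lemma span_base (P : V -> Prop) u : P u -> span P u.
Proof. by move=> Pu; rewrite -[u]scale1r -[1 *: u]addr0; apply: spanD (span0 _). Qed.

Lemma eq_scale (c c' : K) (v : V) : c = c' -> c *: v = c' *: v.
Proof. by move=> ->. Qed.

Lemma scale_congr (c : K) (v v' : V) : v = v' -> c *: v = c *: v'.
Proof. by move=> ->. Qed.

Lemma span_addZ (P : V -> Prop) c u v : span P u -> span P v -> span P (c *: u + v).
Proof.
move=> Pu Pv; elim: Pu => [|c' u' w Pu' _ IHw]; first by rewrite scaler0 add0r.
by rewrite scalerDr scalerA -addrA; apply: spanD.
Qed.

Lemma spanZ (P : V -> Prop) c u : span P u -> span P (c *: u).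
Proof. by move=> Pu; rewrite -[c *: u]addr0; apply: span_addZ (span0 _). Qed.

Lemma span_sum (P : V -> Prop) (I : Type) (s : seq I) (Q : pred I) (F : I -> V) :
  (forall i, Q i -> span P (F i)) -> span P (\sum_(i <- s | Q i) F i).
Proof.
move=> PF; elim/big_ind: _ => // [|u v Pu Pv]; first exact: span0.
by rewrite -[u]scale1r; apply: span_addZ.
Qed.

Lemma span_sub (P Q : V -> Prop) : (forall u, P u -> span Q u) ->
  forall u, span P u -> span Q u.
Proof.
move=> PQ u; elim=> [|c u' v /PQ Qu' _ Qv]; first exact: span0.
exact: span_addZ.
Qed.

End Span.

Section SpanLinear.
Variables (K : pzRingType) (V W : lmodType K).

(** With [span_eq], this reduces statements about homogeneous pieces to their spanning words. *)
Lemma span_linear (P : V -> Prop) (Q : W -> Prop) (f : V -> W) :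
  linear f -> (forall u, P u -> span Q (f u)) -> forall u, span P u -> span Q (f u).
Proof.
move=> lf PQ u; elim=> [|c u' v /PQ Qu' _ Qv]; last by rewrite lf; apply: span_addZ.
have := lf (-1) 0 0; rewrite scaler0 addr0 scaleN1r addNr => ->; exact: span0.
Qed.

Lemma span_eq (P : V -> Prop) (f h : V -> W) :
  linear f -> linear h -> (forall u, P u -> f u = h u) ->
  forall u, span P u -> f u = h u.
Proof.
move=> lf lh E u; elim=> [|c u' v Pu' _ IH]; last by rewrite lf lh IH E.
by rewrite -[0](subrr 0) -scaleN1r addrC lf lh !scaleN1r !addNr.
Qed.

End SpanLinear.

(** * Permutations of three letters *)

Section ThreeLetters.
Local Notation o0 := (ord0 : 'I_3).
Local Notation o1 := (lift ord0 ord0 : 'I_3).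
Local Notation o2 := (lift ord0 (lift ord0 ord0) : 'I_3).

Lemma ord3_cases (i : 'I_3) : [\/ i = o0, i = o1 | i = o2].
Proof.
case: i => [[|[|[|//]]] lt]; [apply: Or31 | apply: Or32 | apply: Or33]; exact: val_inj.
Qed.

Lemma perm3_eq (s t : 'S_3) : s o0 = t o0 -> s o1 = t o1 -> s = t.
Proof.
move=> E0 E1; apply/permP => i; case: (ord3_cases i) => -> //.
case: (ord3_cases (s o2)) => E; case: (ord3_cases (t o2)) => F; rewrite E F //;
case: (ord3_cases (t o0)) => G; case: (ord3_cases (t o1)) => H;
  rewrite ?G ?H in E0 E1; exfalso;
  by [ have := perm_inj (etrans E (esym E0))
     | have := perm_inj (etrans E (esym E1))
     | have := perm_inj (etrans F (esym G))
     | have := perm_inj (etrans F (esym H))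
     | have := perm_inj (etrans G (esym H)) ].
Qed.

(** Products of transpositions are listed because inverses and parities then compute. *)
Lemma perm3_cases (s : 'S_3) :
  [\/ s = 1%g, s = tperm o0 o1 | s = tperm o0 o2] \/
  [\/ s = tperm o1 o2, s = (tperm o0 o1 * tperm o0 o2)%g |
      s = (tperm o0 o2 * tperm o0 o1)%g].
Proof.
case: (ord3_cases (s o0)) => E0; case: (ord3_cases (s o1)) => E1;
  try by have := perm_inj (etrans E0 (esym E1)).
- by left; apply: Or31; apply: perm3_eq; rewrite ?E0 ?E1 perm1.
- by right; apply: Or31; apply: perm3_eq; rewrite ?E0 ?E1 permE.
- by left; apply: Or32; apply: perm3_eq; rewrite ?E0 ?E1 permE.
- by right; apply: Or32; apply: perm3_eq; rewrite ?E0 ?E1 permM !permE.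
- by right; apply: Or33; apply: perm3_eq; rewrite ?E0 ?E1 permM !permE.
- by left; apply: Or33; apply: perm3_eq; rewrite ?E0 ?E1 permE.
Qed.

Lemma prod3_pairs (K : comRingType) (P : pred ('I_3 * 'I_3)) (F : 'I_3 * 'I_3 -> K) :
  \prod_(p : 'I_3 * 'I_3 | (p.1 < p.2)%N && P p) F p =
  (if P (o0, o1) then F (o0, o1) else 1) * (if P (o0, o2) then F (o0, o2) else 1) *
  (if P (o1, o2) then F (o1, o2) else 1).
Proof.
transitivity (\prod_(i < 3) \prod_(j < 3)
    if (i < j)%N && P (i, j) then F (i, j) else 1).
  by rewrite pair_bigA big_mkcond; apply: eq_bigr => -[i j] _.
by rewrite !big_ord_recl !big_ord0 /= !(mul1r, mulr1).
Qed.

Section AssociativeAlgebra.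
Variables (K : comNzRingType) (V : lmodType K) (mul : V -> V -> V).
Local Notation "x ** y" := (mul x y) (at level 40, left associativity).
Hypotheses (mulA : associative mul) (mul_linl : forall y, linear (mul^~ y))
  (mul_linr : forall x, linear (mul x)).

(** The product is a bare bilinear operation in this section, so that the results apply both to
    [ext_mul] and to [weil_mul], names that shield the quotients from unfolding. *)
Lemma amulZl c x y : (c *: x) ** y = c *: (x ** y).
Proof.
have m0 : 0 ** y = 0.
  have := mul_linl y (-1) 0 0; rewrite /= scaler0 addr0 => ->.
  by rewrite scaleN1r addNr.
by have := mul_linl y c x 0; rewrite /= m0 !addr0.
Qed.

Lemma amulZr c x y : x ** (c *: y) = c *: (x ** y).
Proof.
have m0 : x ** 0 = 0.
  have := mul_linr x (-1) 0 0; rewrite /= scaler0 addr0 => ->.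
  by rewrite scaleN1r addNr.
by have := mul_linr x c y 0; rewrite /= m0 !addr0.
Qed.

Lemma amul_suml (I : Type) (s : seq I) (F : I -> V) y :
  (\sum_(i <- s) F i) ** y = \sum_(i <- s) F i ** y.
Proof.
elim: s => [|i s IHs]; first by rewrite !big_nil -[X in X ** y](scale0r 0) amulZl scale0r.
by rewrite !big_cons -IHs -[F i in LHS]scale1r (mul_linl y) scale1r.
Qed.

Lemma amul_sumr (I : Type) (s : seq I) (F : I -> V) x :
  x ** (\sum_(i <- s) F i) = \sum_(i <- s) x ** F i.
Proof.
elim: s => [|i s IHs]; first by rewrite !big_nil -[X in x ** X](scale0r 0) amulZr scale0r.
by rewrite !big_cons -IHs -[F i in LHS]scale1r (mul_linr x) scale1r.
Qed.

Lemma amul_sum3 (I : Type) (S : seq I) (a b c : I -> K) (F : I -> V) :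
  (\sum_(i <- S) a i *: F i) ** (\sum_(i <- S) b i *: F i) **
    (\sum_(i <- S) c i *: F i) =
  \sum_(i <- S) \sum_(j <- S) \sum_(k <- S) (a i * b j * c k) *: (F i ** F j ** F k).
Proof.
rewrite !amul_suml; apply: eq_bigr => i _.
rewrite [_ ** (\sum_(j <- S) b j *: F j)]amul_sumr amul_suml; apply: eq_bigr => j _.
rewrite amul_sumr; apply: eq_bigr => k _.
by rewrite !(amulZl, amulZr) !scalerA; congr (_ *: _); ring.
Qed.

(** Each inversion undone by the sorting costs one factor [- q i j], and the sign of [s] collects
    the minus signs. *)
Lemma perm_sort3 (s : 'S_3) (E : 'I_3 -> V) (q : 'I_3 -> 'I_3 -> K) :
  (forall i j, E i ** E j = (- q i j) *: (E j ** E i)) ->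
  ((-1) ^+ s * \prod_(p : 'I_3 * 'I_3 | (p.1 < p.2)%N
           && ((s^-1)%g p.2 < (s^-1)%g p.1)%N) q p.1 p.2)
    *: (E (s o0) ** E (s o1) ** E (s o2)) =
  E o0 ** E o1 ** E o2.
Proof.
move=> EC; rewrite prod3_pairs /=.
have EEr i j u : u ** E i ** E j = (- q i j) *: (u ** E j ** E i).
  by rewrite -mulA EC amulZr mulA.
case: (perm3_cases s) => -[] ->.
- by rewrite invg1 !perm1 odd_perm1 /= expr0 !mulr1 scale1r.
- rewrite tpermV odd_tperm !permE /= expr1 !mulr1 mulN1r.
  by rewrite -amulZl -EC.
- rewrite tpermV odd_tperm !permE /= expr1.
  rewrite [RHS]EEr (EC o0 o2) amulZl scalerA (EEr o0 o1) scalerA.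
  by congr (_ *: _); ring.
- rewrite tpermV odd_tperm !permE /= expr1 !mul1r mulN1r.
  by rewrite -EEr.
- rewrite invMg !tpermV odd_permM !odd_tperm !permM !permE /= expr0.
  rewrite (EC o0 o1) amulZl (EEr o0 o2) scalerA.
  by congr (_ *: _); ring.
- rewrite invMg !tpermV odd_permM !odd_tperm !permM !permE /= expr0.
  rewrite (EEr o1 o2 (E o0)) (EC o0 o2) amulZl scalerA.
  by congr (_ *: _); ring.
Qed.

End AssociativeAlgebra.

End ThreeLetters.

(** * Sums of words in color commuting elements *)

Section ColorSums.
Variables (K : fieldType) (V : lmodType K) (mul : V -> V -> V).
Local Notation "x ** y" := (mul x y) (at level 40, left associativity).
Hypotheses (mulA : associative mul) (mul_linl : forall y, linear (mul^~ y))
  (mul_linr : forall x, linear (mul x)).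
Variables (I : eqType) (S : seq I) (dp : I -> nat) (q : I -> I -> K) (E H : I -> V).
Hypotheses (q_skew : forall i j, q i j * q j i = 1)
  (EE : forall i j, E i ** E j = (- q i j) *: (E j ** E i))
  (EH : forall i j, E i ** H j = q i j *: (H j ** E i)).

Let mulZl := amulZl mul_linl.
Let mulZr := amulZr mul_linr.

Lemma color_sign_sqr i : q i i * q i i = 1.
Proof. exact: q_skew. Qed.

(** This is [dual_sign] for an abstract matrix [q]; the two are convertible when [q] is [color]. *)
Definition color_sign (a b : I) : K := q a a * q b b * q b a.

Lemma sum_rot3 (F : I -> I -> I -> V) :
  \sum_(a <- S) \sum_(b <- S) \sum_(c <- S) F a b c =
  \sum_(a <- S) \sum_(b <- S) \sum_(c <- S) F b c a.
Proof.
by rewrite [RHS]exchange_big; apply: eq_bigr => b _; rewrite [RHS]exchange_big.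
Qed.

Lemma sum_inner3 (F : I -> I -> I -> V) :
  \sum_(a <- S) \sum_(b <- S) \sum_(c <- S) F a b c =
  \sum_(b <- S) \sum_(c <- S) \sum_(a <- S) F a b c.
Proof. by rewrite exchange_big; apply: eq_bigr => b _; rewrite exchange_big. Qed.

Lemma sum_inner5 (F : I -> I -> I -> I -> I -> K) (X : I -> I -> I -> I -> V) :
  \sum_(a <- S) \sum_(b <- S) \sum_(c <- S) \sum_(p <- S) \sum_(l <- S)
    F a b c p l *: X b c p l =
  \sum_(b <- S) \sum_(c <- S) \sum_(p <- S) \sum_(l <- S)
    (\sum_(a <- S) F a b c p l) *: X b c p l.
Proof.
rewrite sum_inner3; apply: eq_bigr => b _; apply: eq_bigr => c _.
rewrite sum_inner3; apply: eq_bigr => p _; apply: eq_bigr => l _.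
by rewrite scaler_suml.
Qed.

Lemma scale_sum3 (k : K) (F : I -> I -> I -> K) (X : I -> I -> I -> V) :
  \sum_(a <- S) \sum_(b <- S) \sum_(c <- S) (k * F a b c) *: X a b c =
  k *: \sum_(a <- S) \sum_(b <- S) \sum_(c <- S) F a b c *: X a b c.
Proof.
rewrite scaler_sumr; apply: eq_bigr => a _; rewrite scaler_sumr; apply: eq_bigr => b _.
by rewrite scaler_sumr; apply: eq_bigr => c _; rewrite scalerA.
Qed.

Lemma sum_ext3 (F G : I -> I -> I -> V) : (forall a b c, F a b c = G a b c) ->
  \sum_(a <- S) \sum_(b <- S) \sum_(c <- S) F a b c =
  \sum_(a <- S) \sum_(b <- S) \sum_(c <- S) G a b c.
Proof. by move=> FG; do 3!(apply: eq_bigr => ? _). Qed.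

Lemma sum_split3 (F G : I -> I -> I -> V) :
  \sum_(a <- S) \sum_(b <- S) \sum_(c <- S) (F a b c + G a b c) =
  \sum_(a <- S) \sum_(b <- S) \sum_(c <- S) F a b c +
  \sum_(a <- S) \sum_(b <- S) \sum_(c <- S) G a b c.
Proof.
rewrite -big_split; apply: eq_bigr => a _; rewrite -big_split.
by apply: eq_bigr => b _; rewrite -big_split.
Qed.

(** After a cyclic renaming the word is [E c ** H a ** E b]. Moving [H a] to the front costs only a
    color factor; exchanging the two odd letters then gives the minus sign. The remaining factors
    cancel by the cyclic rule for [t], which is the invariance of [B]. *)
Lemma sum_mixed (t : I -> I -> I -> K) (P : I -> I -> I -> bool) :
  (forall a b c, P b c a = P a b c) -> (forall a b c, t b c a = q a a * t a b c) ->
  \sum_(a <- S) \sum_(b <- S) \sum_(c <- S)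
    (if P a b c then q a a * (color_sign b c * t a b c) else 0) *: (E b ** H c ** E a) =
  - \sum_(a <- S) \sum_(b <- S) \sum_(c <- S)
    (if P a b c then color_sign b c * t a b c else 0) *: (H a ** E b ** E c).
Proof.
move=> Prot trot; rewrite sum_rot3 -!sumrN; apply: eq_bigr => a _.
rewrite -!sumrN; apply: eq_bigr => b _; rewrite -!sumrN; apply: eq_bigr => c _.
rewrite Prot; case: ifP => _; last by rewrite !scale0r oppr0.
rewrite EH mulZl -mulA EE mulZr mulA !scalerA -scaleNr; congr (_ *: _).
rewrite /color_sign trot.
have := color_sign_sqr a; have := color_sign_sqr b; have := color_sign_sqr c.
have := q_skew a c; have := q_skew a b; have := q_skew b c.
move=> bc ab ac c2 b2 a2.
transitivity (- (q a a * q a a) * (q a c * q c a) * (q b b * q c c * q c b * t a b c)).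
  by ring.
by rewrite a2 ac; ring.
Qed.

(** [Z] stands for a component of dW(A), which is even: it passes odd letters with a color factor
    and no sign. Moved to the front, the second and third Leibniz terms become the first one with
    indices renamed, because [f] absorbs the color factors, and its skewness also the Leibniz
    sign. *)
Lemma sum_sym3 (f : I -> I -> I -> K) (Z : I -> nat -> V) :
  (forall i j n, E i ** Z j n = q i j *: (Z j n ** E i)) ->
  (forall a b c, f a b c = - q b a * f b a c) ->
  (forall a b c, f a b c = q b a * q c a * f b c a) ->
  \sum_(a <- S) \sum_(b <- S) \sum_(c <- S) f a b c *:
    (Z a (dp b + dp c)%N ** (E b ** E c) - E a ** (Z b (dp a + dp c)%N ** E c)
     + E a ** (E b ** Z c (dp a + dp b)%N)) =
  3%:R *: \sum_(a <- S) \sum_(b <- S) \sum_(c <- S)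
    f a b c *: (Z a (dp b + dp c)%N ** (E b ** E c)).
Proof.
move=> EZ fs fr.
pose U a b c := f a b c *: (Z a (dp b + dp c)%N ** (E b ** E c)).
rewrite (@sum_ext3 _ (fun a b c => U a b c + U b a c + U c a b)) => [|a b c].
  rewrite !sum_split3; have -> : \sum_(a <- S) \sum_(b <- S) \sum_(c <- S) U c a b =
    \sum_(a <- S) \sum_(b <- S) \sum_(c <- S) U a b c by rewrite !(sum_rot3 U) sum_rot3.
  rewrite [X in _ + X + _]exchange_big /=.
  by rewrite -!mulr2n -mulrSr scaler_nat.
rewrite /U !scalerDr scalerN; congr (_ + _ + _).
  rewrite mulA EZ mulZl -mulA scalerA -scaleNr; congr (_ *: _).
  by rewrite [RHS]fs; ring.
rewrite mulA -mulA EZ mulZr [E a ** _]mulA EZ mulZl -mulA !scalerA; congr (_ *: _).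
by rewrite [f c a b]fr; ring.
Qed.

(* By the Jacobi identity for k, the sum J satisfies J = - J - J after renaming
   the indices. *)
Lemma sum_jacobi (k : I -> I -> I -> I -> K) (P : I -> I -> I -> I -> bool) :
  3%:R != 0 :> K ->
  (forall b c p l, P b c p l = P b p c l) -> (forall b c p l, P b c p l = P b p l c) ->
  (forall b c p l, k b c p l = - (q c l * q p l * k b l c p) + q c p * k b p c l) ->
  \sum_(b <- S) \sum_(c <- S) \sum_(p <- S) \sum_(l <- S)
    (if P b c p l then color_sign b c * color_sign p l * k b c p l else 0) *:
      (E p ** E l ** (E b ** E c)) = 0.
Proof.
(* [kJ] permutes only the last three indices of [k], so the sum vanishes for each [b] separately. *)
move=> n3 Psw Prot kJ; apply: big1 => b _.
pose U c p l := (if P b c p l then color_sign b c * color_sign p l * k b c p l else 0) *: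
      (E p ** E l ** (E b ** E c)).
pose A c p l := (if P b c p l then color_sign b c * color_sign p l *
  - (q c l * q p l * k b l c p) else 0) *: (E p ** E l ** (E b ** E c)).
pose D c p l := (if P b c p l then color_sign b c * color_sign p l *
  (q c p * k b p c l) else 0) *: (E p ** E l ** (E b ** E c)).
have EEr i j u : u ** E i ** E j = (- q i j) *: (u ** E j ** E i).
  by rewrite -mulA EE mulZr mulA.
have UAD : forall c p l, U c p l = A c p l + D c p l.
  move=> c p l; rewrite -scalerDl; congr (_ *: _); case: ifP => _; last by rewrite addr0.
  by rewrite -mulrDr kJ.
(* Both [A p l c] and [D p c l] contain [k b c p l], so here and in [DU] it remains to sort the
   word; the color factors cancel in pairs. *)
have AU : forall c p l, A p l c = - U c p l.
  move=> c p l; rewrite -scaleNr /A /U !mulA.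
  rewrite (EEr b p) (EEr c p) (EE l p) !mulZl (EEr c b) !scalerA; congr (_ *: _).
  rewrite -(Prot b c p l); case: ifP => _; last by rewrite !mul0r oppr0.
  rewrite /color_sign.
  transitivity (- ((q b p * q p b) * (q c p * q p c) * (q c l * q l c)) *
    (q b b * q c c * q c b * (q p p * q l l * q l p) * k b c p l)); first by ring.
  by rewrite !q_skew; ring.
have DU : forall c p l, D p c l = - U c p l.
  move=> c p l; rewrite -scaleNr /D /U !mulA.
  rewrite (EEr b p) (EEr l p) (EE c p) !mulZl (EEr c l) mulZl (EEr c b) !scalerA.
  congr (_ *: _); rewrite (Psw b p c l); case: ifP => _; last by rewrite !mul0r oppr0.
  rewrite /color_sign.
  transitivity (- ((q b p * q p b) * (q c p * q p c) * (q c l * q l c)) *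
    (q b b * q c c * q c b * (q p p * q l l * q l p) * k b c p l)); first by ring.
  by rewrite !q_skew; ring.
have sumN (F : I -> I -> I -> V) :
    \sum_(c <- S) \sum_(p <- S) \sum_(l <- S) - F c p l =
    - \sum_(c <- S) \sum_(p <- S) \sum_(l <- S) F c p l.
  rewrite -sumrN; apply: eq_bigr => c _; rewrite -sumrN; apply: eq_bigr => p _.
  by rewrite -sumrN.
pose J := \sum_(c <- S) \sum_(p <- S) \sum_(l <- S) U c p l.
have JAD : J = - J - J.
  rewrite {1}/J (sum_ext3 UAD) sum_split3; congr (_ + _).
    by rewrite sum_rot3 (sum_ext3 AU) sumN.
  by rewrite exchange_big (sum_ext3 DU) sumN.
suff : 3%:R *: J = 0 by move=> /eqP; rewrite scaler_eq0 (negPf n3) => /eqP.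
by rewrite scaler_nat mulrSr mulr2n {1}JAD -addrA -opprD addNr.
Qed.

End ColorSums.

(** * Generators of the Weil algebra *)

Section ColorAlgebras.
Variables (R : realType) (Gam : zmodType) (eps : Gam -> Gam -> R[i]).
Hypothesis Heps : commutation_factor eps.
Variable g : quadColorLie eps.
Local Notation C := (R[i]).

Lemma weil_scaleAl (c : C) (u v : Weil g) : (c *: u) * v = c *: (u * v).
Proof. exact/esym/presAlg_scaleAl. Qed.

Lemma weil_scaleAr (c : C) (u v : Weil g) : u * (c *: v) = c *: (u * v).
Proof. exact/esym/presAlg_scaleAr. Qed.

Lemma ext_scaleAl (c : C) (u v : colorExt g) : (c *: u) * v = c *: (u * v).
Proof. exact/esym/presAlg_scaleAl. Qed.

Lemma ext_scaleAr (c : C) (u v : colorExt g) : u * (c *: v) = c *: (u * v).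
Proof. exact/esym/presAlg_scaleAr. Qed.

Lemma color_scaleAl s (c : C) (u v : colorAlg g s) : (c *: u) * v = c *: (u * v).
Proof. exact/esym/presAlg_scaleAl. Qed.

Lemma color_scaleAr s (c : C) (u v : colorAlg g s) : u * (c *: v) = c *: (u * v).
Proof. exact/esym/presAlg_scaleAr. Qed.

Lemma tens_linearl b : linear (fun a => tens a b : Weil g).
Proof.
move=> c a a'; rewrite /tens /gen.
rewrite (presAlg_rel (weil_rel_linl c a a' b)) -pi_presAlgD.
by rewrite -pi_presAlgZ.
Qed.

Lemma tens_linearr a : linear (fun b => tens a b : Weil g).
Proof.
move=> c b b'; rewrite /tens /gen.
rewrite (presAlg_rel (weil_rel_linr c a b b')) -pi_presAlgD.
by rewrite -pi_presAlgZ.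
Qed.

HB.instance Definition _ a :=
  GRing.isLinear.Build C (colorExt g) (Weil g) *:%R (tens a) (tens_linearr a).

Lemma tens11 : tens 1 1 = 1 :> Weil g.
Proof. exact: (presAlg_rel (weil_rel_one g)). Qed.

Lemma tensM k d l d' (a a' : colorSym g) (b b' : colorExt g) :
  piece xpredT k d b -> piece xpredT l d' a' ->
  tens a b * tens a' b' = eps d.2 d'.2 *: tens (a * a') (b * b').
Proof.
move=> pb pa; have /presAlg_rel := weil_rel_mul a b' pb pa.
by rewrite -pi_presAlgM -pi_presAlgZ.
Qed.

Lemma cgen_linear s : linear (@cgen R Gam eps g s).
Proof.
move=> c x y; rewrite /cgen /gen.
rewrite (presAlg_rel (color_rel_lin s c x y)) -pi_presAlgD.
by rewrite -pi_presAlgZ.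
Qed.

HB.instance Definition _ s :=
  GRing.isLinear.Build C g (colorAlg g s) *:%R (@cgen R Gam eps g s) (cgen_linear s).

Lemma cgen_comm s d d' (x y : g) : homog d x -> homog d' y ->
  cgen s x * cgen s y = (s * eps d.2 d'.2) *: (cgen s y * cgen s x).
Proof.
move=> hx hy; exact: (gen_comm (color_rel_comm s hx hy)).
Qed.

(* Without the lock, comparing two generators up to conversion unfolds the
   quotients, and rewriting does not terminate in practice. *)
Definition weil_gen : bool -> g -> Weil g :=
  locked (fun p x => if p then tens 1 (ext_gen x) else tens (sym_gen x) 1).

Lemma weil_genT x : weil_gen true x = tens 1 (ext_gen x).
Proof. by rewrite /weil_gen -lock. Qed.

Lemma weil_genF x : weil_gen false x = tens (sym_gen x) 1.
Proof. by rewrite /weil_gen -lock. Qed.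

Lemma weil_gen_linear p : linear (weil_gen p).
Proof.
case: p => c x y; rewrite ?(weil_genT, weil_genF).
  by rewrite [ext_gen (c *: x + y)](cgen_linear _ c) tens_linearr.
by rewrite [sym_gen (c *: x + y)](cgen_linear _ c) tens_linearl.
Qed.

HB.instance Definition _ p :=
  GRing.isLinear.Build C g (Weil g) *:%R (weil_gen p) (weil_gen_linear p).

Lemma cf0l a : eps 0 a = 1.
Proof.
have := cf_Dl Heps 0 0 a; rewrite addr0 => /eqP.
rewrite -subr_eq0 -{1}[eps 0 a]mulr1 -mulrBr mulf_eq0 => /orP[/eqP e0|].
  by have := cf_skew Heps 0 a; rewrite e0 mul0r => /esym/eqP; rewrite oner_eq0.
by rewrite subr_eq0 => /eqP.
Qed.

Lemma cf_unit a b : eps a b != 0.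
Proof.
by apply/eqP => e0; have := cf_skew Heps a b; rewrite e0 mul0r => /esym/eqP; rewrite oner_eq0.
Qed.

Lemma cf_inv a b : eps a b = (eps b a)^-1.
Proof. by apply: (mulIf (cf_unit b a)); rewrite (cf_skew Heps) mulVf ?cf_unit. Qed.

Lemma cf0r a : eps a 0 = 1.
Proof. by rewrite cf_inv cf0l invr1. Qed.

Lemma cfNl a b : eps (- a) b = (eps a b)^-1.
Proof.
by apply: (mulIf (cf_unit a b)); rewrite mulVf ?cf_unit // -(cf_Dl Heps) addNr cf0l.
Qed.

Lemma cfNr a b : eps a (- b) = (eps a b)^-1.
Proof. by rewrite cf_inv cfNl [eps a b]cf_inv. Qed.

Lemma cf_sqr a : eps a a * eps a a = 1.
Proof. exact: (cf_skew Heps). Qed.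

End ColorAlgebras.

(** * Dual bases *)

Section QuadraticColorLie.
Variables (R : realType) (Gam : zmodType) (eps : Gam -> Gam -> R[i]).
Hypothesis Heps : commutation_factor eps.
Variable g : quadColorLie eps.
Local Notation C := (R[i]).
Local Notation pr := (@qc_pr R Gam eps g).
Local Notation br := (@qc_br R Gam eps g).
Local Notation B := (@qc_form R Gam eps g).

HB.instance Definition _ d :=
  GRing.isLinear.Build C g g *:%R (pr d) (@qc_pr_linear _ _ _ g d).
HB.instance Definition _ x :=
  GRing.isLinear.Build C g g *:%R (@qc_br R Gam eps g x) (@qc_br_linearr _ _ _ g x).
HB.instance Definition _ x :=
  GRing.isLinear.Build C g C *%R (B x) (@qc_form_linearr _ _ _ g x).

Lemma form_suml (I : Type) (s : seq I) (c : I -> C) (x : I -> g) y :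
  B (\sum_(i <- s) c i *: x i) y = \sum_(i <- s) c i * B (x i) y.
Proof.
elim: s => [|i s IHs].
  rewrite !big_nil; have := qc_form_linearl y (-1) (0 : g) 0.
  by rewrite scaler0 addr0 mulN1r addNr.
by rewrite !big_cons (qc_form_linearl y) IHs.
Qed.

Lemma form_sumr (I : Type) (s : seq I) (c : I -> C) (x : I -> g) y :
  B y (\sum_(i <- s) c i *: x i) = \sum_(i <- s) c i * B y (x i).
Proof. by rewrite raddf_sum; apply: eq_bigr => i _; exact: scalarZ. Qed.

Lemma formZr c x y : B y (c *: x) = c * B y x.
Proof. exact: scalarZ. Qed.

Lemma form_deg d d' x y : homog d x -> homog d' y -> d + d' != 0 -> B x y = 0.
Proof. exact: qc_form_graded. Qed.

Lemma homog_pr d x : homog d (pr d x).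
Proof. by rewrite /homog qc_pr_pr eqxx. Qed.

Lemma pr_homog d d' x : homog d x -> pr d' x = if d' == d then x else 0.
Proof. by move=> hx; rewrite -{1}hx qc_pr_pr; case: eqP => // ->. Qed.

Lemma homog_br d d' x y : homog d x -> homog d' y -> homog (d + d') (br x y).
Proof. exact: qc_br_graded. Qed.

Lemma form_pr d d' x y :
  homog d' x -> B x (pr d y) = if d' + d == 0 then B x y else 0.
Proof.
move=> hx; case: eqP => [dd0|/eqP dd0]; last exact: form_deg hx (homog_pr _ _) dd0.
have [s us ->] := qc_pr_sum y.
rewrite !linear_sum /=; apply: eq_bigr => d'' _.
rewrite qc_pr_pr; case: eqP => [->//|/eqP nd].
rewrite linear0 (form_deg hx (homog_pr _ _)) //.
by apply: contra_neq nd => E; apply: (addrI d'); rewrite dd0.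
Qed.

(** Nondegeneracy is given in the first argument, and the symmetry of [B] for homogeneous elements;
    hence the passage through the components of [y]. *)
Lemma form_nondegr y : (forall x, B x y = 0) -> y = 0.
Proof.
move=> By0; have [s us ->] := qc_pr_sum y; rewrite big1_seq // => d /andP[_ ds].
apply: qc_form_nondeg => z; have [t ut ->] := qc_pr_sum z.
rewrite linear_sum big1_seq //= => d' _.
rewrite (qc_form_sym (homog_pr _ _) (homog_pr _ _)).
by rewrite (form_pr _ _ (homog_pr d' z)) By0; case: ifP; rewrite mulr0.
Qed.

(** Cyclic form of invariance. Where the pairing is nonzero the bracket has degree [- d3], so the
    factor from the symmetry of [B] reduces to [eps d3.2 d3.2]. *)
Lemma form_brA d1 d2 d3 x y z : homog d1 x -> homog d2 y -> homog d3 z ->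
  B x (br y z) = eps d3.2 d3.2 * B z (br x y).
Proof.
move=> hx hy hz; rewrite -qc_form_inv.
have [d0|nd0] := eqVneq (d1 + d2 + d3) 0; last first.
  rewrite (form_deg (homog_br hx hy) hz nd0).
  rewrite (form_deg hz (homog_br hx hy)) ?mulr0 //.
  by rewrite addrC.
rewrite (qc_form_sym (homog_br hx hy) hz) //.
move/eqP: d0; rewrite addr_eq0 => /eqP ->.
by rewrite /= (cfNl Heps) -(cf_inv Heps).
Qed.

Variable e : homogBasis g.
Local Notation I := (hb_idx e).
Local Notation ev := (hb_vec (h := e)).
Local Notation dv := (hb_dual (h := e)).
Local Notation dg := (hb_deg (h := e)).
Local Notation ed a := (hb_deg (h := e) a).2.

Lemma hb_nondegr y y' : (forall b, B (ev b) y = B (ev b) y') -> y = y'.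
Proof.
move=> Eb; apply/eqP; rewrite -subr_eq0; apply/eqP/form_nondegr => x.
have [s [c -> ]] := hb_span e x; rewrite form_suml big1 // => b _.
by rewrite linearB /= Eb subrr mulr0.
Qed.

(** Pairings with the basis determine a vector. Projection to degree [- dg a] only kills pairings
    with basis vectors of degree other than [dg a], and those already vanish by duality. *)
Lemma hb_dual_homog a : homog (- dg a) (dv a).
Proof.
apply: hb_nondegr => b; rewrite (form_pr _ _ (hb_homog b)) hb_dualP.
by case: (eqVneq b a) => [->|_]; rewrite ?subrr ?eqxx // if_same.
Qed.

Lemma hb_sgn2 a : eps (ed a) (ed a) * eps (ed a) (ed a) = 1.
Proof. exact: cf_sqr. Qed.

(** Otherwise one could pick one more basis vector of Z-degree [i] than the spanning list [sG] has
    entries; the coordinate matrix then has more rows than columns, and a nonzero row in its kernel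
    contradicts [hb_free]. *)
Lemma hb_deg_finite (i : int) : exists s : seq I, forall a, (dg a).1 = i -> a \in s.
Proof.
have [sG spanG] := @qc_fin_dim _ _ _ g i.
apply/not_existsP => nfin.
have [t [ut szt degt]] : exists t : seq I, [/\ uniq t, size t = (size sG).+1 &
    forall a, a \in t -> (dg a).1 = i].
  elim: (_.+1) => [|n [t [ut szt degt]]]; first by exists [::].
  have /existsNP[a /not_implyP[dega /negP at_]] := nfin t.
  exists (a :: t); split; rewrite /= ?at_ ?szt // => b; rewrite inE => /orP[/eqP->//|].
  exact: degt.
have coord a : exists c : g -> C, (dg a).1 = i -> ev a = \sum_(y <- sG) c y *: y.
  have [da|] := eqVneq (dg a).1 i; last by move=> /eqP nd; exists (fun=> 0) => /nd.
  have [|c Ec] := spanG (ev a); last by exists c.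
  move=> d nd; rewrite (pr_homog _ (hb_homog a)); case: eqP => // dE.
  by move: nd; rewrite dE da eqxx.
have {coord}[c Ec] := boolp.choice coord.
pose m := size sG.
pose a0 (j : 'I_m.+1) : I := tnth (Tuple (introT eqP szt)) j.
pose A : 'M[C]_(m.+1, m) := \matrix_(j, k) c (a0 j) (nth 0 sG k).
have a0t j : a0 j \in t by rewrite /a0 mem_tnth.
have : kermx A != 0.
  rewrite -mxrank_eq0 mxrank_ker subn_eq0 -ltnNge.
  exact: leq_ltn_trans (rank_leq_col A) _.
case/rowV0Pn => v /sub_kermxP vA0 /eqP; apply; apply/rowP => j; rewrite mxE.
(* [hb_free] takes coefficients on all of [I]: the kernel row is carried over by the position in
   [t], with value 0 outside [t]. *)
pose f a := if insub (index a t) is Some j' then v 0 j' else 0.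
have fa0 j' : f (a0 j') = v 0 j'.
  rewrite /f /a0 (tnth_nth (a0 ord0)) /= index_uniq ?szt //.
  by rewrite insubT //= => lt; congr (v 0 _); apply: val_inj.
rewrite -fa0; apply: (hb_free ut) (a0t j).
rewrite -[t in LHS]/(tval (Tuple (introT eqP szt))) big_tuple.
under eq_bigr => k _.
  rewrite -/(a0 k) fa0 (Ec _ (degt _ (a0t k))) (big_nth 0) big_mkord scaler_sumr.
  over.
rewrite exchange_big /= big1 // => k _.
under eq_bigr do rewrite scalerA.
rewrite -scaler_suml; have /rowP/(_ k) := vA0.
rewrite !mxE => E; rewrite [X in X *: _](_ : _ = 0) ?scale0r // -[RHS]E.
by apply: eq_bigr => l _; rewrite mxE.
Qed.

Definition zdeg (a : I) : nat := absz (dg a).1.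

(* In component r, a word of total degree 0 only involves basis vectors with
   [zdeg a <= r]; the sums over S below are thus the full sums. *)
Lemma hb_range M : exists2 S : seq I, uniq S & forall a, (a \in S) = (zdeg a <= M)%N.
Proof.
suff [s sP] : exists s : seq I, forall a, (zdeg a <= M)%N -> a \in s.
  exists (undup [seq a <- s | zdeg a <= M]%N); first exact: undup_uniq.
  move=> a; rewrite mem_undup mem_filter; case: leqP => //= aM.
  by rewrite sP.
elim: M => [|M [s sP]].
  have [s sP] := hb_deg_finite 0; exists s => a.
  by rewrite leqn0 absz_eq0 => /eqP/sP.
have [s1 s1P] := hb_deg_finite M.+1%:Z; have [s2 s2P] := hb_deg_finite (- M.+1%:Z).
exists (s ++ s1 ++ s2) => a; rewrite leq_eqVlt ltnS !mem_cat => /orP[/eqP E|/sP->//].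
have [E1|E1] : (dg a).1 = M.+1%:Z \/ (dg a).1 = - M.+1%:Z by move: E; rewrite /zdeg; lia.
- by rewrite (s1P _ E1) orbT.
- by rewrite (s2P _ E1) !orbT.
Qed.

Section Range.
Variables (M : nat) (S : seq I).
Hypotheses (uS : uniq S) (SP : forall a, (a \in S) = (zdeg a <= M)%N).

Lemma sum_pick (V : lmodType C) (F : I -> V) b :
  \sum_(a <- S) (b == a)%:R *: F a = if b \in S then F b else 0.
Proof.
case: ifP => bS.
  rewrite (bigD1_seq b) //= eqxx scale1r big1 ?addr0 // => a /negPf.
  by rewrite eq_sym => ->; rewrite scale0r.
rewrite big1_seq // => a /andP[_ aS]; case: eqP => [ba|]; last by rewrite scale0r.
by rewrite ba aS in bS.
Qed.

Lemma form_range d z a : homog d z -> (absz d.1 <= M)%N -> a \notin S ->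
  B (ev a) z = 0.
Proof.
move=> hz dM; rewrite SP => aS; apply: (form_deg (hb_homog a) hz).
apply: contra aS => /eqP/(congr1 fst) /= E; move: dM E; rewrite /zdeg; lia.
Qed.

(** Only basis vectors of Z-degree opposite to that of [z] pair with it, and the range is symmetric
    about 0: it contains all the contributing indices or none. *)
Lemma dual_expand d z : homog d z ->
  \sum_(a <- S) B (ev a) z *: dv a = if (absz d.1 <= M)%N then z else 0.
Proof.
move=> hz; case: ifPn => dM; last first.
  rewrite big1_seq // => a /andP[_]; rewrite SP => aM.
  rewrite (form_deg (hb_homog a) hz) ?scale0r //.
  apply: contra dM => /eqP/(congr1 fst) /= E; move: aM E; rewrite /zdeg; lia.
apply: hb_nondegr => b; rewrite form_sumr.
under eq_bigr do rewrite hb_dualP mulrC.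
rewrite (sum_pick (V := C^o) (fun a => B (ev a) z)).
by case: ifPn => // /(form_range hz dM) ->.
Qed.

(** The roles of basis and dual are exchanged here; the factor [eps d.2 d.2] comes from the exchange
    of arguments in [B (dv a) (ev a)]. *)
Lemma vec_expand d z : homog d z ->
  \sum_(a <- S) B (dv a) z *: ev a =
  if (absz d.1 <= M)%N then eps d.2 d.2 *: z else 0.
Proof.
move=> hz; case: ifPn => dM; last first.
  rewrite big1_seq // => a /andP[_]; rewrite SP => aM.
  rewrite (form_deg (hb_dual_homog a) hz) ?scale0r //.
  apply: contra dM => /eqP/(congr1 fst) /= E; move: aM E; rewrite /zdeg; lia.
apply: hb_nondegr => b; rewrite form_sumr formZr.
have [bS|bS] := boolP (b \in S); last first.
  rewrite (form_range hz dM bS) mulr0 big1_seq // => a /andP[_].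
  by rewrite SP => aM; rewrite (form_range (hb_homog a) aM bS) mulr0.
(* Both sides are paired with [ev b]; writing [ev b] in the dual vectors allows a comparison term by
   term. *)
have := dual_expand (hb_homog b); rewrite -/(zdeg b) -SP bS => Eb.
rewrite -[in RHS]Eb form_suml mulr_sumr; apply: eq_bigr => a _.
have [da|nda] := eqVneq (- dg a + d) 0; last first.
  by rewrite (form_deg (hb_dual_homog a) hz nda) !(mul0r, mulr0).
have {da}da : dg a = d by apply/esym/eqP; rewrite -subr_eq0 addrC da.
have [db|ndb] := eqVneq (dg b + dg a) 0; last first.
  rewrite (form_deg (hb_homog b) (hb_homog a) ndb).
  rewrite (form_deg (hb_homog a) (hb_homog b)) ?(mul0r, mulr0) //.
  by rewrite addrC.
rewrite (qc_form_sym (hb_homog b) (hb_homog a)).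
move/eqP: db; rewrite addr_eq0 => /eqP ->.
rewrite (cfNl Heps) -(cf_inv Heps) da; ring.
Qed.
End Range.

End QuadraticColorLie.

(** * The gradings of the Weil algebra and its completion *)

Section WeilWords.
Variables (R : realType) (Gam : zmodType) (eps : Gam -> Gam -> R[i]).
Hypothesis Heps : commutation_factor eps.
Variable g : quadColorLie eps.
Local Notation deg := (int * Gam)%type.

Lemma piece1 s (Q : pred int) : piece Q 0 0 (1 : colorAlg g s).
Proof. exact/span_base/word0. Qed.

Lemma piece_gen s (Q : pred int) d x : Q d.1 -> homog d x ->
  piece Q 1 d (cgen s x : colorAlg g s).
Proof.
move=> Qd hx; apply: span_base; rewrite -[cgen s x]mulr1 -[d]addr0.
exact: (wordS Qd hx (word0 g s Q)).
Qed.

Lemma piece_genM s (Q : pred int) k d d' x (u : colorAlg g s) :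
  Q d.1 -> homog d x -> piece Q k d' u -> piece Q k.+1 (d + d') (cgen s x * u).
Proof.
move=> Qd hx; apply: span_linear => [c v w|v wv].
  by rewrite mulrDr color_scaleAr.
exact/span_base/wordS.
Qed.

Lemma pieceT s (Q : pred int) k d (u : colorAlg g s) :
  piece Q k d u -> piece xpredT k d u.
Proof.
apply: span_sub => v wv; apply: span_base.
by elim: wv => [|d' x k' d'' w _ hx _ IH]; [exact: word0 | exact: wordS].
Qed.

Lemma piece_comm s (Q : pred int) k d d' x (u : colorAlg g s) :
  homog d x -> piece Q k d' u ->
  u * cgen s x = (s ^+ k * eps d'.2 d.2) *: (cgen s x * u).
Proof.
move=> hx; move: u; apply: span_eq => [c v w|c v w|u].
- by rewrite mulrDl color_scaleAl.
- by rewrite mulrDr color_scaleAr scalerDr !scalerA mulrC.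
elim=> [|d1 y k' d2 w Qd1 hy _ IH].
  by rewrite mul1r mulr1 expr0 cf0l // mulr1 scale1r.
rewrite -mulrA IH color_scaleAr mulrA (cgen_comm s hy hx) color_scaleAl scalerA.
rewrite -[in LHS](mulrA (cgen s x)); apply: eq_scale.
by rewrite /= (cf_Dl Heps) exprS; ring.
Qed.

Lemma tens_split (a : colorSym g) (b : colorExt g) : tens a 1 * tens 1 b = tens a b.
Proof.
by rewrite (tensM _ _ (piece1 _ xpredT) (piece1 _ xpredT)) cf0l // scale1r mulr1 mul1r.
Qed.

Lemma weil_genFl d x k d' (a : colorSym g) b : homog d x -> piece xpredT k d' a ->
  weil_gen false x * tens a b = tens (sym_gen x * a) b.
Proof.
move=> hx pa; rewrite weil_genF; have := tensM (sym_gen x) b (piece1 _ xpredT) pa.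
by rewrite cf0l // scale1r mul1r.
Qed.

Lemma weil_genTl d x k d' (a : colorSym g) b : homog d x -> piece xpredT k d' a ->
  weil_gen true x * tens a b = eps d.2 d'.2 *: tens a (ext_gen x * b).
Proof.
move=> hx pa; rewrite weil_genT; have := tensM 1 b (piece_gen (-1) (Q := xpredT) isT hx) pa.
by rewrite mul1r.
Qed.

Lemma weil_genFr d x l d' (a : colorSym g) b : homog d x -> piece xpredT l d' b ->
  tens a b * weil_gen false x = eps d'.2 d.2 *: tens (a * sym_gen x) b.
Proof.
move=> hx pb; rewrite weil_genF; have := tensM a 1 pb (piece_gen 1 (Q := xpredT) isT hx).
by rewrite mulr1.
Qed.

Lemma weil_genTr d x l d' (a : colorSym g) b : homog d x -> piece xpredT l d' b ->
  tens a b * weil_gen true x = tens a (b * ext_gen x).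
Proof.
move=> hx pb; rewrite weil_genT; have := tensM a (ext_gen x) pb (piece1 _ xpredT).
by rewrite cf0r // scale1r mulr1.
Qed.

Lemma tensZl c (a : colorSym g) b : tens (c *: a) b = c *: tens a b.
Proof.
have t0 : tens (0 : colorSym g) b = 0.
  have := tens_linearl b (-1) (0 : colorSym g) 0.
  by rewrite scaler0 addr0 scaleN1r addNr.
by have := tens_linearl b c a 0; rewrite addr0 t0 addr0.
Qed.

Lemma tensZr c (a : colorSym g) b : tens a (c *: b) = c *: tens a b.
Proof. exact: linearZ. Qed.

(** Passing [a] is governed by the product rule, with no sign; only an odd generator passing the [l]
    exterior letters of [b] picks up one -1 for each. *)
Lemma weil_gen_tens_comm p d x k l d1 d2 (a : colorSym g) b :
  homog d x -> piece xpredT k d1 a -> piece xpredT l d2 b ->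
  weil_gen p x * tens a b =
    ((-1) ^+ (p && odd l) * eps d.2 (d1 + d2).2) *: (tens a b * weil_gen p x).
Proof.
move=> hx pa pb; case: p => /=.
  rewrite (weil_genTl _ hx pa) (weil_genTr _ hx pb) (piece_comm hx pb).
  rewrite tensZr [RHS]scalerA; apply: eq_scale.
  rewrite signr_odd (cf_Dr Heps) mulrACA -expr2 sqrr_sign mul1r -mulrA.
  by rewrite (cf_skew Heps) mulr1.
rewrite (weil_genFl _ hx pa) (weil_genFr _ hx pb) /sym_gen (piece_comm hx pa).
rewrite tensZl !scalerA -[LHS]scale1r; apply: eq_scale; apply/esym.
rewrite expr1n expr0 (cf_Dr Heps) !mul1r -[_ * eps d2.2 d.2]mulrA.
by rewrite (cf_skew Heps) mulr1 (cf_skew Heps).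
Qed.

Lemma weil_gen_comm p q d d' (x y : g) : homog d x -> homog d' y ->
  weil_gen p x * weil_gen q y =
    ((-1) ^+ (p && q) * eps d.2 d'.2) *: (weil_gen q y * weil_gen p x).
Proof.
move=> hx hy; case: q.
  rewrite [weil_gen true y]weil_genT.
  by rewrite (weil_gen_tens_comm _ hx (piece1 _ xpredT) (piece_gen _ _ hy)) ?add0r.
rewrite [weil_gen false y]weil_genF.
by rewrite (weil_gen_tens_comm _ hx (piece_gen _ _ hy) (piece1 _ xpredT)) ?addr0.
Qed.

Lemma weil_gen_piece p (Q : pred int) d d' x (v : Weil g) :
  Q d.1 -> homog d x -> weil_piece Q d' v -> weil_piece Q (d + d') (weil_gen p x * v).
Proof.
move=> Qd hx; apply: span_linear => [c u w|u]; first by rewrite mulrDr weil_scaleAr.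
case=> k [l [d1 [d2 [a [b [pa pb <- ->]]]]]].
case: p.
  rewrite (weil_genTl _ hx (pieceT pa)); apply/spanZ/span_base.
  exists k, l.+1, d1, (d + d2), a, (ext_gen x * b); split=> //; last by rewrite addrCA.
  exact: piece_genM.
rewrite (weil_genFl _ hx (pieceT pa)); apply: span_base.
exists k.+1, l, (d + d1), d2, (sym_gen x * a), b; split=> //; last by rewrite addrA.
exact: piece_genM.
Qed.

(* The contribution of a generator of degree d to the index r of a component. *)
Definition posn (d : deg) : nat := absz (Num.max d.1 0).

(** A generator of nonpositive degree joins the left factor and leaves [r] unchanged. One of
    positive degree is moved across the left factor, up to a scalar, into the right factor, whose
    Z-degree is [r]. *)
Lemma weil_gen_cpiece p d d' r x (v : Weil g) : homog d x -> weil_cpiece d' r v ->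
  weil_cpiece (d + d') (posn d + r) (weil_gen p x * v).
Proof.
move=> hx; apply: span_linear => [c u w|u]; first by rewrite mulrDr weil_scaleAr.
case=> d1 [d2 [v1 [v2 [pv1 pv2 <- d2r ->]]]].
have [dle|dgt] := lerP d.1 0.
  apply: span_base; exists (d + d1), d2, (weil_gen p x * v1), v2; split.
  - exact: weil_gen_piece.
  - by [].
  - by rewrite addrA.
  - by rewrite d2r /posn max_r.
  - by rewrite mulrA.
rewrite mulrA; move: v1 pv1; apply: span_linear => [c w w'|v1].
  by rewrite mulrDr mulrDl weil_scaleAr weil_scaleAl.
case=> k [l [e1 [e2 [a [b [pa pb ee ->]]]]]].
rewrite (weil_gen_tens_comm _ hx (pieceT pa) (pieceT pb)) weil_scaleAl -mulrA.
apply/spanZ/span_base; exists d1, (d + d2), (tens a b), (weil_gen p x * v2); split.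
- by apply: span_base; exists k, l, e1, e2, a, b.
- exact: weil_gen_piece.
- by rewrite addrCA.
- by move: d2r dgt; rewrite /posn /=; lia.
- by [].
Qed.

Lemma weil_cpiece1 : weil_cpiece 0 0 (1 : Weil g).
Proof.
have p1 Q : weil_piece Q 0 (1 : Weil g).
  apply: span_base; exists 0%N, 0%N, 0, 0, 1, 1; split.
  - exact: piece1.
  - exact: piece1.
  - by rewrite addr0.
  - by rewrite tens11.
apply: span_base; exists 0, 0, 1, 1; split.
- exact: p1.
- exact: p1.
- by rewrite addr0.
- by [].
- by rewrite mulr1.
Qed.

End WeilWords.

(** * Components of products and brackets in the completion *)

Section CompletedWeil.
Variables (R : realType) (Gam : zmodType) (eps : Gam -> Gam -> R[i]).
Hypothesis Heps : commutation_factor eps.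
Variable g : quadColorLie eps.
Local Notation deg := (int * Gam)%type.
Local Notation br := (@qc_br R Gam eps g).
Local Notation B := (@qc_form R Gam eps g).

Implicit Types (u v : weil_seq g) (w : Weil g).

Lemma weil_seqDE u v n : (u + v) n = u n + v n. Proof. by []. Qed.
Lemma weil_seqNE u n : (- u) n = - u n. Proof. by []. Qed.
Lemma weil_seqZE c u n : (c *: u) n = c *: u n. Proof. by []. Qed.

Lemma weil_seq_sumE (I : Type) (s : seq I) (P : pred I) (F : I -> weil_seq g) n :
  (\sum_(i <- s | P i) F i) n = \sum_(i <- s | P i) F i n.
Proof. by elim/big_rec2: _ => // i x u _ <-. Qed.

(** By [univ_delta] a homogeneous generator has a single component, so Cauchy products of generators
    become products in the Weil algebra placed at the sum of the indices. *)
Definition delta (n : nat) w : weil_seq g := fun r => if r == n then w else 0.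

Lemma deltaE n w r : delta n w r = if r == n then w else 0.
Proof. by []. Qed.

Definition univ : bool -> g -> weil_seq g :=
  locked (fun p => if p then @Auniv _ _ _ g else @Funiv _ _ _ g).

Lemma univT : univ true = @Auniv _ _ _ g.
Proof. by rewrite /univ -lock. Qed.

Lemma univF : univ false = @Funiv _ _ _ g.
Proof. by rewrite /univ -lock. Qed.

Lemma cpart_homog (d : deg) (x : g) r : homog d x -> cpart r x = if posn d == r then x else 0.
Proof.
move=> hx; rewrite /cpart; case: eqP => [dr|ndr].
  rewrite (fsbigE [:: d]) //=.
  - by rewrite big_cons big_nil mem_set //= addr0 hx.
  - by move=> d' /=; rewrite inE => /eqP ->.
  - by move=> d' _; rewrite inE (pr_homog _ hx) => /negPf ->.
apply: fsbig1 => d' /= d'r; rewrite (pr_homog _ hx); case: eqP => // dd'.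
by case: ndr; rewrite -dd'.
Qed.

Lemma univ_delta p (d : deg) (x : g) : homog d x -> univ p x = delta (posn d) (weil_gen p x).
Proof.
move=> hx; apply/funext => r.
have -> : univ p x r = weil_gen p (cpart r x).
  by case: p; rewrite ?univT ?univF ?weil_genT ?weil_genF.
have wp0 : weil_gen p (0 : g) = 0 by exact: linear0.
by rewrite /delta eq_sym (cpart_homog _ hx) (fun_if (weil_gen p)) wp0.
Qed.

Lemma cmul_deltal m w v r :
  cmul (delta m w) v r = if (m <= r)%N then w * v (r - m)%N else 0.
Proof.
rewrite /cmul /delta; case: leqP => mr.
  rewrite (bigD1 (Ordinal (mr : (m < r.+1)%N))) //= eqxx big1 ?addr0 // => k.
  by rewrite -val_eqE /= => /negPf ->; rewrite mul0r.
rewrite big1 // => k _; case: eqP => [km|]; last by rewrite mul0r.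
by have := ltn_ord k; rewrite ltnS km leqNgt mr.
Qed.

Lemma cmul_deltar n w u r :
  cmul u (delta n w) r = if (n <= r)%N then u (r - n)%N * w else 0.
Proof.
rewrite /cmul /delta; case: leqP => nr.
  have lt : (r - n < r.+1)%N by rewrite ltnS leq_subr.
  rewrite (bigD1 (Ordinal lt)) //= subKn // eqxx big1 ?addr0 // => k.
  rewrite -val_eqE /= => nk; case: eqP => [E|]; last by rewrite mulr0.
  by case/eqP: nk; rewrite -E subKn // -ltnS.
rewrite big1 // => k _; case: eqP => [E|]; last by rewrite mulr0.
by move: nr; rewrite -E ltnNge leq_subr.
Qed.

Lemma cmul_delta m n w w' : cmul (delta m w) (delta n w') = delta (m + n) (w * w').
Proof.
apply/funext => r; rewrite cmul_deltal /delta; case: leqP => mr; last first.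
  by case: eqP => // E; move: mr; rewrite E ltnNge leq_addr.
rewrite -(eqn_add2r m) subnK // addnC.
by case: eqP; rewrite ?mulr0.
Qed.

Lemma tens_genE (x y : g) : tens_gen x y = cmul (univ false x) (univ true y).
Proof.
by rewrite univT univF; apply/funext => r; apply: eq_bigr => k _; rewrite (tens_split Heps).
Qed.

Lemma in_deg_delta d n w : weil_cpiece d n w -> in_deg d (delta n w).
Proof. by move=> pw r; rewrite /delta; case: eqP => [->//|_]; exact: span0. Qed.

Lemma in_degZ d c u : in_deg d u -> in_deg d (c *: u).
Proof. move=> du r; exact/spanZ/du. Qed.

Lemma in_degD d u v : in_deg d u -> in_deg d v -> in_deg d (u + v).
Proof.
move=> du dv r; rewrite weil_seqDE -[u r]scale1r.
by apply: span_addZ; [exact: du | exact: dv].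
Qed.

Lemma in_deg_sum d (I : Type) (s : seq I) (P : pred I) (F : I -> weil_seq g) :
  (forall i, P i -> in_deg d (F i)) -> in_deg d (\sum_(i <- s | P i) F i).
Proof. by move=> dF r; rewrite weil_seq_sumE; apply: span_sum => i /dF/(_ r). Qed.

Lemma in_deg_What d u : in_deg d u -> in_What u.
Proof.
move=> du; exists [:: d], (fun d' => if d' == d then u else 0); split; last first.
  by rewrite big_seq1 eqxx.
by move=> d'; case: eqP => [->//|_] r; exact: span0.
Qed.

Lemma weil_gen_mul1 p d (x : g) : homog d x -> weil_cpiece d (posn d) (weil_gen p x).
Proof.
move=> hx; have := weil_gen_cpiece Heps p hx (weil_cpiece1 g).
by rewrite mulr1 addr0 addn0.
Qed.

Lemma univ_in_deg p d (x : g) : homog d x -> in_deg d (univ p x).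
Proof. by move=> hx; rewrite (univ_delta p hx); exact/in_deg_delta/weil_gen_mul1. Qed.

Lemma univ2_in_deg p q d d' (x y : g) : homog d x -> homog d' y ->
  in_deg (d + d') (cmul (univ p x) (univ q y)).
Proof.
move=> hx hy; rewrite (univ_delta p hx) (univ_delta q hy) cmul_delta.
exact/in_deg_delta/(weil_gen_cpiece Heps p hx)/weil_gen_mul1.
Qed.

Lemma univ3_in_deg p q r d d' d'' (x y z : g) : homog d x -> homog d' y -> homog d'' z ->
  in_deg (d + (d' + d'')) (cmul (univ p x) (cmul (univ q y) (univ r z))).
Proof.
move=> hx hy hz.
rewrite (univ_delta p hx) (univ_delta q hy) (univ_delta r hz) !cmul_delta.
exact/in_deg_delta/(weil_gen_cpiece Heps p hx)/(weil_gen_cpiece Heps q hy)/weil_gen_mul1.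
Qed.

Lemma univ_parity p (d : deg) (x : g) : homog d x -> has_parity p (univ p x).
Proof.
move=> hx n; rewrite (univ_delta p hx) /delta; case: eqP => _; last exact: span0.
apply: span_base; case: p; rewrite ?weil_genT ?weil_genF.
  exists 1%N, d, 1, (ext_gen x); split.
  - exact: (piece_gen (-1) (Q := xpredT)).
  - by [].
  - by [].
exists 0%N, 0, (sym_gen x), 1; split.
- exact: piece1.
- by [].
- by [].
Qed.

Variable e : homogBasis g.
Local Notation I := (hb_idx e).
Local Notation ev := (hb_vec (h := e)).
Local Notation dv := (hb_dual (h := e)).
Local Notation dg := (hb_deg (h := e)).

Definition dposn (a : I) : nat := posn (- dg a).

Lemma univ_dual p a : univ p (dv a) = delta (dposn a) (weil_gen p (dv a)).
Proof. exact/univ_delta/hb_dual_homog. Qed.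

Lemma csum_pairE M (S : seq I) (f : I * I -> weil_seq g) n :
  uniq S -> (forall a, (a \in S) = (zdeg a <= M)%N) ->
  (forall p, f p n != 0 -> (zdeg p.1 <= M)%N /\ (zdeg p.2 <= M)%N) ->
  csum f n = \sum_(b <- S) \sum_(c <- S) f (b, c) n.
Proof.
move=> uS SP f0; rewrite /csum (fsbigE [seq (b, c) | b <- S, c <- S]) //=.
- transitivity (\sum_(p <- [seq (b, c) | b <- S, c <- S]) f p n).
    by apply: eq_bigl => p; rewrite mem_set.
  by rewrite big_allpairs_dep.
- by rewrite allpairs_uniq // => -[? ?] [? ?].
move=> [b c] _ bc; apply/eqP; apply: contraNT bc => /f0[/= bM cM].
by apply/allpairsP; exists (b, c); rewrite !SP.
Qed.

(** In a nonzero term the degrees of [x], [ev b] and [ev c] cancel and the contributions of the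
    duals add up to [n]. The bound on [n] then controls the negative Z-degrees of the basis vectors,
    the bound on [n - d.1] the positive ones. *)
Lemma conn_bracketE M (S : seq I) p q d (x : g) n :
  uniq S -> (forall a, (a \in S) = (zdeg a <= M)%N) -> homog d x ->
  n%:Z <= M%:Z -> n%:Z - d.1 <= M%:Z ->
  conn_bracket e (univ p) (univ q) x n =
  - (2^-1 *: \sum_(b <- S) \sum_(c <- S)
      (if (dposn b + dposn c == n)%N
       then dual_sign b c * B x (br (ev b) (ev c)) else 0)
        *: (weil_gen p (dv b) * weil_gen q (dv c))).
Proof.
move=> uS SP hx nM ndM; rewrite /conn_bracket weil_seqNE weil_seqZE.
rewrite (csum_pairE uS SP) => [|[b c]]; last first.
  rewrite weil_seqZE !univ_dual cmul_delta /delta => nz.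
  have nE : n = (dposn b + dposn c)%N.
    by apply/eqP; apply: contraNT nz => /negPf ->; rewrite scaler0.
  have dE : d + (dg b + dg c) = 0.
    apply/eqP; apply: contraNT nz => dE; rewrite (form_deg hx _ dE).
      by rewrite mulr0 scale0r.
    exact/homog_br/hb_homog/hb_homog.
  have {dE} := congr1 fst dE; move: nM ndM; rewrite nE /= /dposn /posn /zdeg /=; lia.
do 2!apply: congr1; apply: eq_bigr => b _; apply: eq_bigr => c _.
rewrite weil_seqZE !univ_dual cmul_delta /delta eq_sym.
by case: ifP; rewrite ?scale0r ?scaler0.
Qed.

End CompletedWeil.

Lemma scale_addZ (K : pzRingType) (V : lmodType K) (k c c' c'' : K) (v : V) :
  c' = k * c + c'' -> c' *: v = k *: (c *: v) + c'' *: v.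
Proof. by move=> ->; rewrite scalerDl scalerA. Qed.

(** * The structure constants tensor *)

Section StructureTensor.
Variables (R : realType) (Gam : zmodType) (eps : Gam -> Gam -> R[i]).
Hypothesis Heps : commutation_factor eps.
Variable g : quadColorLie eps.
Local Notation C := (R[i]).
Local Notation deg := (int * Gam)%type.
Local Notation br := (@qc_br R Gam eps g).
Local Notation B := (@qc_form R Gam eps g).
Local Notation ext x := (ext_gen x : colorExt g).
Local Notation o0 := (ord0 : 'I_3).
Local Notation o1 := (lift ord0 ord0 : 'I_3).
Local Notation o2 := (lift ord0 (lift ord0 ord0) : 'I_3).

Definition ext_mul (u v : colorExt g) : colorExt g := u * v.

Lemma ext_mulE u v : u * v = ext_mul u v.
Proof. by []. Qed.

Lemma ext_mulA : associative ext_mul.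
Proof. by move=> u v w; exact: mulrA. Qed.

Lemma ext_mul_linl v : linear (ext_mul^~ v).
Proof. by move=> c u w; rewrite /ext_mul mulrDl ext_scaleAl. Qed.

Lemma ext_mul_linr u : linear (ext_mul u).
Proof. by move=> c v w; rewrite /ext_mul mulrDr ext_scaleAr. Qed.

Definition ext3 (x y z : g) : colorExt g := ext_mul (ext_mul (ext x) (ext y)) (ext z).

Lemma ext_mul_comm d d' (x y : g) : homog d x -> homog d' y ->
  ext_mul (ext x) (ext y) = (- eps d.2 d'.2) *: ext_mul (ext y) (ext x).
Proof. by move=> hx hy; rewrite -mulN1r; exact: (cgen_comm _ hx hy). Qed.

Lemma perm_sign_ext3 (s : 'S_3) (x : 'I_3 -> g) (d : 'I_3 -> deg) :
  (forall i, homog (d i) (x i)) ->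
  perm_sign eps s d *: ext3 (x (s o0)) (x (s o1)) (x (s o2)) = ext3 (x o0) (x o1) (x o2).
Proof.
move=> hx.
have := @perm_sort3 _ _ _ ext_mulA ext_mul_linl ext_mul_linr s (fun i => ext (x i))
  (fun i j => eps (d i).2 (d j).2).
by apply=> i j; exact: ext_mul_comm.
Qed.

Variable e : homogBasis g.
Local Notation I := (hb_idx e).
Local Notation ev := (hb_vec (h := e)).
Local Notation dv := (hb_dual (h := e)).
Local Notation dg := (hb_deg (h := e)).
Local Notation ed a := (hb_deg (h := e) a).2.
Local Notation sg a := (eps (ed a) (ed a)).

Variables (W : colorExt g -> colorExt g -> C).
Hypothesis HW : wedge_form W.

Lemma form_sgn d (x : g) a : homog d x -> sg a * B x (ev a) = B (ev a) x.
Proof.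
move=> hx; have [da|nda] := eqVneq (dg a + d) 0; last first.
  rewrite (form_deg (hb_homog a) hx nda) (form_deg hx (hb_homog a)) ?mulr0 //.
  by rewrite addrC.
rewrite (qc_form_sym (hb_homog a) hx); move/eqP: da; rewrite addrC addr_eq0 => /eqP ->.
by rewrite /= (cfNr Heps) -(cf_inv Heps).
Qed.

Lemma wedge_form3 (x y : 'I_3 -> g) (d d' : 'I_3 -> deg) :
  (forall i, homog (d i) (x i)) -> (forall i, homog (d' i) (y i)) ->
  W (ext3 (x o0) (x o1) (x o2)) (ext3 (y o0) (y o1) (y o2)) =
  \sum_(s : 'S_3) perm_sign eps s d *
    (B (x (s o2)) (y o0) * (B (x (s o1)) (y o1) * B (x (s o0)) (y o2))).
Proof.
have prodE (z : 'I_3 -> g) : ext3 (z o0) (z o1) (z o2) = \prod_(i < 3) ext (z i).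
  by rewrite !big_ord_recl big_ord0 [X in _ = _ * (_ * X)]mulr1 /ext3 -ext_mulA.
move=> hx hy; rewrite !prodE (wf_words HW hx hy); apply: eq_bigr => s _; congr (_ * _).
rewrite !big_ord_recl big_ord0 mulr1.
by congr (B (x (s _)) _ * (B (x (s _)) _ * B (x (s _)) _)); apply: val_inj.
Qed.

Variables (M : nat) (S : seq I).
Hypotheses (uS : uniq S) (SP : forall a, (a \in S) = (zdeg a <= M)%N).

(** The test word is reversed because the pairing matches the last letter with the first. The three
    signs turn each [B (x i) (ev a)] into [B (ev a) (x i)], the coordinate of [x i] along [dv a].
    The filter discards only vanishing terms, as nonzero pairings force opposite degrees. *)
Lemma ext3_expand (x : 'I_3 -> g) (d : 'I_3 -> deg) r :
  (forall i, homog (d i) (x i)) -> (forall i, (absz (d i).1 <= M)%N) ->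
  r = (\sum_i posn (d i))%N ->
  6%:R *: ext3 (x o0) (x o1) (x o2) =
  \sum_(a <- S) \sum_(b <- S) \sum_(c <- S)
    (if (dposn a + dposn b + dposn c == r)%N
     then sg a * sg b * sg c * W (ext3 (x o0) (x o1) (x o2)) (ext3 (ev c) (ev b) (ev a))
     else 0) *: ext3 (dv a) (dv b) (dv c).
Proof.
move=> hx dM rE.
have coefE a b c :
    (if (dposn a + dposn b + dposn c == r)%N
     then sg a * sg b * sg c * W (ext3 (x o0) (x o1) (x o2)) (ext3 (ev c) (ev b) (ev a))
     else 0) = \sum_(s : 'S_3) perm_sign eps s d *
       (B (ev a) (x (s o0)) * B (ev b) (x (s o1)) * B (ev c) (x (s o2))).
  pose y i := nth (ev c) [:: ev c; ev b; ev a] (i : 'I_3).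
  pose dy i := nth (dg c) [:: dg c; dg b; dg a] (i : 'I_3).
  have hy i : homog (dy i) (y i).
    by case: i => [[|[|[|//]]] lt] /=; exact: hb_homog.
  rewrite (wedge_form3 (y := y) hx hy) /= mulr_sumr.
  case: ifPn => [_|abc].
    apply: eq_bigr => s _; rewrite /y /=.
    rewrite -(form_sgn a (hx (s o0))) -(form_sgn b (hx (s o1))) -(form_sgn c (hx (s o2))).
    ring.
  rewrite big1 // => s _.
  have [da|nda] := eqVneq (dg a + d (s o0)) 0; last first.
    by rewrite (form_deg (hb_homog a) (hx _) nda) !mul0r mulr0.
  have [db|ndb] := eqVneq (dg b + d (s o1)) 0; last first.
    by rewrite (form_deg (hb_homog b) (hx _) ndb) mulr0 mul0r mulr0.
  have [dc|ndc] := eqVneq (dg c + d (s o2)) 0; last first.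
    by rewrite (form_deg (hb_homog c) (hx _) ndc) !mulr0.
  case/eqP: abc; rewrite rE (reindex_inj (@perm_inj _ s)) /=.
  rewrite !big_ord_recl big_ord0 addn0 addnA.
  have dE u v : u + v = 0 -> v = - u :> deg.
    by move=> /eqP; rewrite addrC addr_eq0 => /eqP.
  by rewrite (dE _ _ da) (dE _ _ db) (dE _ _ dc).
under eq_bigr do under eq_bigr do under eq_bigr do rewrite coefE scaler_suml.
under eq_bigr do under eq_bigr do rewrite exchange_big.
under eq_bigr do rewrite exchange_big.
rewrite exchange_big /=.
(* For a fixed permutation the triple sum factors into three dual expansions and gives the permuted
   word, which the permutation sign sorts. *)
rewrite (eq_bigr (fun=> ext3 (x o0) (x o1) (x o2))) => [|s _]; last first.
  rewrite -[RHS](perm_sign_ext3 s hx).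
  under eq_bigr do under eq_bigr do under eq_bigr do rewrite -scalerA.
  under eq_bigr do under eq_bigr do rewrite -scaler_sumr.
  under eq_bigr do rewrite -scaler_sumr.
  rewrite -scaler_sumr; apply: congr1.
  have xE i : \sum_(a <- S) B (ev a) (x i) *: ext (dv a) = ext (x i).
    have := dual_expand uS SP (hx i); rewrite dM => {2}<-.
    by rewrite [RHS]linear_sum; apply: eq_bigr => a _; rewrite [RHS]linearZ.
  rewrite /ext3.
  move: (xE (s o0)) (xE (s o1)) (xE (s o2)) => <- <- <-.
  exact: (esym (amul_sum3 ext_mul_linl ext_mul_linr S _ _ _ (fun a => ext (dv a)))).
have card6 : #|{: {perm 'I_3}}| = 6%N := card_Sn 3.
by rewrite sumr_const card6 scaler_nat.
Qed.

(** In place of the split into a nonpositive and a positive factor used by [ext_cpiece], the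
    component is read off the individual letters. *)
Definition word3 (r : nat) (v : colorExt g) : Prop :=
  exists (x : 'I_3 -> g) (d : 'I_3 -> deg),
  [/\ forall i, homog (d i) (x i), \sum_i d i = 0, (\sum_i posn (d i) = r)%N &
      v = ext3 (x o0) (x o1) (x o2)].

Lemma word_seqP (Q : pred int) k d (u : colorExt g) : word Q k d u ->
  exists l : seq (deg * g), [/\ size l = k, forall p, p \in l -> Q p.1.1,
    forall p, p \in l -> homog p.1 p.2, \sum_(p <- l) p.1 = d &
    u = \prod_(p <- l) ext p.2].
Proof.
elim=> [|d1 x k' d' w Qd hx _ [l [sl lQ lh ld ->]]].
  by exists [::]; split; rewrite ?big_nil.
exists ((d1, x) :: l); split; rewrite /= ?sl ?big_cons ?ld //.
- by move=> p; rewrite inE => /orP[/eqP->|/lQ].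
- by move=> p; rewrite inE => /orP[/eqP->|/lh].
Qed.

Lemma word3_of_seq (l : seq (deg * g)) r : size l = 3%N ->
  (forall p, p \in l -> homog p.1 p.2) -> \sum_(p <- l) p.1 = 0 ->
  (\sum_(p <- l) posn p.1 = r)%N -> word3 r (\prod_(p <- l) ext p.2).
Proof.
case: l => [|p0 [|p1 [|p2 [|]]]] // _ lh; rewrite !big_cons !big_nil => l0 lr.
exists (fun i : 'I_3 => (nth p0 [:: p0; p1; p2] i).2).
exists (fun i : 'I_3 => (nth p0 [:: p0; p1; p2] i).1); split.
- move=> i; apply: lh; case: i => [[|[|[|//]]] lt] /=; by rewrite !inE eqxx ?orbT.
- by rewrite !big_ord_recl big_ord0.
- by rewrite !big_ord_recl big_ord0.
- by rewrite [X in _ * (_ * X)]mulr1 /ext3 -ext_mulA.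
Qed.

Lemma posn_sum_nonpos (l : seq (deg * g)) : (forall p, p \in l -> p.1.1 <= 0) ->
  (\sum_(p <- l) posn p.1 = 0)%N.
Proof.
by move=> lQ; rewrite big1_seq // => p /andP[_ /lQ p0]; rewrite /posn max_r.
Qed.

Lemma posn_sum_pos (l : seq (deg * g)) : (forall p, p \in l -> 0 < p.1.1) ->
  (\sum_(p <- l) posn p.1)%:Z = (\sum_(p <- l) p.1).1.
Proof.
elim: l => [|p l IHl] lQ; first by rewrite !big_nil.
rewrite !big_cons /= PoszD IHl => [|q ql]; last by apply: lQ; rewrite inE ql orbT.
by congr (_ + _); have p0 := lQ p (mem_head _ _); rewrite /posn max_l ?gez0_abs // ltW.
Qed.

(** Letters of the left factor contribute 0 to the index, and those of the right factor their
    Z-degrees, which add up to [d2.1 = r]. *)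
Lemma ext_cpiece_word3 r (v : colorExt g) : ext_cpiece 3 0 r v -> span (word3 r) v.
Proof.
apply: span_sub => {}v [k1 [k2 [d1 [d2 [u [w [pu pw k12 d12 [d2r ->]]]]]]]].
move: u pu; apply: span_linear => [c u u'|u wu]; first by rewrite mulrDl ext_scaleAl.
move: w pw; apply: span_linear => [c w w'|w ww]; first by rewrite mulrDr ext_scaleAr.
have [l [sl lQ lh ld ->]] := word_seqP wu.
have [l' [sl' lQ' lh' ld' ->]] := word_seqP ww.
apply: span_base; rewrite -big_cat; apply: word3_of_seq.
- by rewrite size_cat sl sl'.
- by move=> p; rewrite mem_cat => /orP[/lh|/lh'].
- by rewrite big_cat /= ld ld'.
- rewrite big_cat /= (posn_sum_nonpos lQ) add0n.
  by have := posn_sum_pos lQ'; rewrite ld' d2r => -[].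
Qed.

(* The six permutations in the pairing contribute equally, so that a triple
   product is recovered from its pairings with basis vectors. *)
Lemma word3_proj r v : (r <= M)%N -> span (word3 r) v ->
  6%:R *: v = \sum_(a <- S) \sum_(b <- S) \sum_(c <- S)
    (if (dposn a + dposn b + dposn c == r)%N
     then sg a * sg b * sg c * W v (ext3 (ev c) (ev b) (ev a)) else 0)
      *: ext3 (dv a) (dv b) (dv c).
Proof.
move=> rM; move: v; apply: span_eq => [c u v|k u v|v].
- by rewrite scalerDr !scalerA mulrC.
- rewrite scaler_sumr -big_split; apply: eq_bigr => a _.
  rewrite scaler_sumr -big_split; apply: eq_bigr => b _.
  rewrite scaler_sumr -big_split; apply: eq_bigr => c _.
  apply: scale_addZ.
  case: ifP => _; last by rewrite mulr0 addr0.
  by rewrite (wf_linearl HW); ring.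
case=> x [d [hx d0 dr ->]]; apply: (ext3_expand (d := d)) => // i.
have := congr1 fst d0; move: dr rM; rewrite /posn.
rewrite !big_ord_recl !big_ord0 /=.
by case: (ord3_cases i) => ->; lia.
Qed.

(** Against a fixed triple of basis vectors only one component of phi can pair nontrivially; this
    collapses the sum over all components in [structure_tensor]. *)
Lemma wedge_word3_0 r v a b c : span (word3 r) v ->
  (dposn a + dposn b + dposn c != r)%N -> W v (ext3 (ev c) (ev b) (ev a)) = 0.
Proof.
move=> wv nr; elim: wv => [|k u w [x [d [hx d0 dr ->]]] _ IH].
  by have := wf_linearl HW (ext3 (ev c) (ev b) (ev a)) (-1) 0 0;
    rewrite /= scaler0 addr0 mulN1r addNr.
rewrite (wf_linearl HW) IH addr0.
pose y i := nth (ev c) [:: ev c; ev b; ev a] (i : 'I_3).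
pose dy i := nth (dg c) [:: dg c; dg b; dg a] (i : 'I_3).
have hy i : homog (dy i) (y i) by case: i => [[|[|[|//]]] lt] /=; exact: hb_homog.
rewrite (wedge_form3 (y := y) hx hy) /= big1 ?mulr0 // => s _.
have [da|nda] := eqVneq (d (s o0) + dg a) 0; last first.
  by rewrite (form_deg (hx _) (hb_homog a) nda) !mulr0.
have [db|ndb] := eqVneq (d (s o1) + dg b) 0; last first.
  by rewrite (form_deg (hx _) (hb_homog b) ndb) mul0r !mulr0.
have [dc|ndc] := eqVneq (d (s o2) + dg c) 0; last first.
  by rewrite (form_deg (hx _) (hb_homog c) ndc) mul0r mulr0.
case/eqP: nr; rewrite -dr (reindex_inj (@perm_inj _ s)) /=.
rewrite !big_ord_recl big_ord0 addn0 addnA.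
have dE u' v' : u' + v' = 0 -> u' = - v' :> deg.
  by move=> /eqP; rewrite addr_eq0 => /eqP.
by rewrite (dE _ _ da) (dE _ _ db) (dE _ _ dc).
Qed.

(** The pairing with the reversed triple is prescribed by [structure_tensor]; 12 is the 6 of
    [word3_proj] times the 2 of that prescription. *)
Lemma structure_tensorE (phi : nat -> colorExt g) r : structure_tensor W phi ->
  (r <= M)%N ->
  phi r = \sum_(a <- S) \sum_(b <- S) \sum_(c <- S)
    (if (dposn a + dposn b + dposn c == r)%N
     then 12%:R^-1 * dual_sign b c * B (ev a) (br (ev b) (ev c)) else 0)
      *: ext3 (dv a) (dv b) (dv c).
Proof.
move=> [phi_word phiW] rM.
have phi3 n : span (word3 n) (phi n) by exact/ext_cpiece_word3.
have n6 : 6%:R != 0 :> C by rewrite pnatr_eq0.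
rewrite -[LHS](scalerK n6) (word3_proj rM (phi3 r)).
rewrite scaler_sumr; apply: eq_bigr => a _.
rewrite scaler_sumr; apply: eq_bigr => b _.
rewrite scaler_sumr; apply: eq_bigr => c _.
rewrite scalerA; apply: eq_scale; case: ifP => [/eqP abc|_]; last by rewrite mulr0.
have -> : W (phi r) (ext3 (ev c) (ev b) (ev a)) = - (2^-1 * B (br (ev c) (ev b)) (ev a)).
  rewrite -(phiW _ _ _ _ _ _ (hb_homog c) (hb_homog b) (hb_homog a)).
  rewrite (fsbigE [:: r]) //=; first by rewrite big_cons big_nil mem_set // addr0.
  move=> n _; rewrite inE => /eqP nr; apply: (wedge_word3_0 (phi3 n)).
  by rewrite abc eq_sym; exact/eqP.
(* The minus sign from reversing the bracket cancels the one in the definition of phi; the color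
   factor joins [sg b * sg c] to form [dual_sign b c]. *)
have -> : B (br (ev c) (ev b)) (ev a) =
    - (eps (ed c) (ed b) * sg a * B (ev a) (br (ev b) (ev c))).
  have [d0|nd0] := eqVneq (dg a + (dg b + dg c)) 0; last first.
    rewrite (form_deg (hb_homog a) (homog_br (hb_homog b) (hb_homog c)) nd0).
    rewrite (form_deg (homog_br (hb_homog c) (hb_homog b)) (hb_homog a)).
      by rewrite mulr0 oppr0.
    by rewrite addrC [dg c + _]addrC.
  rewrite (qc_form_sym (homog_br (hb_homog c) (hb_homog b)) (hb_homog a)).
  rewrite (qc_br_skew (hb_homog c) (hb_homog b)) -scaleNr formZr.
  have -> : dg c + dg b = - dg a.
    by apply/eqP; rewrite -addr_eq0 addrC [dg c + _]addrC d0.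
  by rewrite /= (cfNl Heps) -(cf_inv Heps); ring.
rewrite /dual_sign; have := hb_sgn2 Heps a.
move: (sg a) (B _ _) => s t ss.
rewrite (_ : 12%:R = 6%:R * 2%:R :> C) ?invfM; last by rewrite -natrM.
transitivity (6%:R^-1 * 2%:R^-1 * (s * s) * (sg b * sg c * eps (ed c) (ed b)) * t).
  by ring.
by rewrite ss; ring.
Qed.

End StructureTensor.

(** * The differential of the cubic Dirac element *)

Section CubicDirac.
Variables (R : realType) (Gam : zmodType) (eps : Gam -> Gam -> R[i]).
Hypothesis Heps : commutation_factor eps.
Variable g : quadColorLie eps.
Local Notation C := (R[i]).
Local Notation br := (@qc_br R Gam eps g).
Local Notation B := (@qc_form R Gam eps g).
Variable e : homogBasis g.
Local Notation I := (hb_idx e).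
Local Notation ev := (hb_vec (h := e)).
Local Notation dv := (hb_dual (h := e)).
Local Notation dg := (hb_deg (h := e)).
Local Notation ed a := (hb_deg (h := e) a).2.

Definition weil_mul : Weil g -> Weil g -> Weil g := locked *%R.

Lemma weil_mulE u v : u * v = weil_mul u v.
Proof. by rewrite /weil_mul -lock. Qed.

Lemma weil_mulA : associative weil_mul.
Proof. by move=> u v w; rewrite -!weil_mulE; exact: mulrA. Qed.

Lemma weil_mul_linl v : linear (weil_mul^~ v).
Proof. by move=> c u w; rewrite -!weil_mulE mulrDl weil_scaleAl. Qed.

Lemma weil_mul_linr u : linear (weil_mul u).
Proof. by move=> c v w; rewrite -!weil_mulE mulrDr weil_scaleAr. Qed.

Definition dual_gen (p : bool) (a : I) : Weil g := weil_gen p (dv a).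
Definition color (a b : I) : C := eps (ed a) (ed b).
Definition triple (a b c : I) : C := B (ev a) (br (ev b) (ev c)).
Local Notation E := (dual_gen true).
Local Notation H := (dual_gen false).
Local Notation q := color.
Local Notation t := triple.

(** Passing to duals negates both degrees, which leaves the commutation factor unchanged. *)
Lemma gen_dual_comm p p' a b :
  weil_mul (dual_gen p a) (dual_gen p' b) =
  ((-1) ^+ (p && p') * q a b) *: weil_mul (dual_gen p' b) (dual_gen p a).
Proof.
have := weil_gen_comm Heps p p' (hb_dual_homog a) (hb_dual_homog b).
by rewrite !weil_mulE /= (cfNl Heps) (cfNr Heps) invrK.
Qed.

Lemma color_skew a b : q a b * q b a = 1. Proof. exact: cf_skew. Qed.

Lemma dual_ext_comm a b : weil_mul (E a) (E b) = (- q a b) *: weil_mul (E b) (E a).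
Proof. by rewrite [LHS]gen_dual_comm /= expr1 mulN1r. Qed.

Lemma dual_ext_sym_comm a b : weil_mul (E a) (H b) = q a b *: weil_mul (H b) (E a).
Proof. by rewrite [LHS]gen_dual_comm /= expr0 mul1r. Qed.

Lemma triple_deg a b c : t a b c != 0 -> dg a + (dg b + dg c) = 0.
Proof.
move=> t0; apply/eqP; apply: contraNT t0 => nd.
by rewrite /triple (form_deg (hb_homog a) (homog_br (hb_homog b) (hb_homog c)) nd).
Qed.

Lemma triple_rot a b c : t b c a = q a a * t a b c.
Proof.
rewrite /triple (form_brA Heps (hb_homog b) (hb_homog c) (hb_homog a)).
by [].
Qed.

Definition cubic_coef a b c : C := 12%:R^-1 * (dual_sign b c * t a b c).
Local Notation f := cubic_coef.

Lemma cubic_coef_deg a b c : f a b c != 0 -> dg a + (dg b + dg c) = 0.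
Proof.
move=> f0; apply: triple_deg; apply: contraNneq f0 => t0.
by rewrite /cubic_coef t0 !mulr0.
Qed.

(** Invariance rotates the triple, but [dual_sign] is not cyclic by itself: the two signs match only
    because the three degrees cancel, which rewrites [q b a] as [q b b * q c b]. *)
Lemma cubic_coef_rot a b c : f a b c = q b a * q c a * f b c a.
Proof.
rewrite /cubic_coef [t b c a]triple_rot /dual_sign -!/(color _ _).
have [t0|t0] := eqVneq (t a b c) 0;  first by rewrite t0 !mulr0.
have aE : dg a = - (dg b + dg c) by apply/eqP; rewrite -addr_eq0 triple_deg.
have qba : q b a = q b b * q c b.
  by rewrite /color aE /= (cfNr Heps) (cf_Dr Heps) invfM -!(cf_inv Heps).
have ca := color_skew c a; have a2 := color_skew a a.
rewrite qba.
transitivity (12%:R^-1 * (q a a * q a a) * (q c a * q a c) *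
  (q b b * q c c * q c b * t a b c)); last by ring.
by rewrite a2 ca; ring.
Qed.

Lemma triple_skew a b c : t a b c = - (q b c * t a c b).
Proof.
by rewrite /triple (qc_br_skew (hb_homog b) (hb_homog c)) -scaleNr formZr mulNr.
Qed.

Lemma cubic_coef_skewr a b c : f a b c = - q c b * f a c b.
Proof.
rewrite /cubic_coef triple_skew /dual_sign -!/(color _ _).
transitivity (- 12%:R^-1 * (q b c * q c b) * (q b b * q c c * t a c b)); first by ring.
by rewrite color_skew mulr1; have := color_skew c b => cb;
  transitivity (- 12%:R^-1 * (q c b * q b c) * (q b b * q c c * t a c b));
  [rewrite cb mulr1 | ring].
Qed.

Lemma cubic_coef_skew a b c : f a b c = - q b a * f b a c.
Proof.
rewrite cubic_coef_rot (cubic_coef_skewr b c a).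
transitivity (- q b a * (q c a * q a c) * f b a c); first by ring.
by rewrite color_skew mulr1.
Qed.

End CubicDirac.

(** * Finite truncations of the cubic Dirac element, and continuity *)

Section Truncation.
Variables (R : realType) (Gam : zmodType) (eps : Gam -> Gam -> R[i]).
Hypothesis Heps : commutation_factor eps.
Variable g : quadColorLie eps.
Local Notation C := (R[i]).
Variable e : homogBasis g.
Local Notation I := (hb_idx e).
Local Notation ev := (hb_vec (h := e)).
Local Notation dv := (hb_dual (h := e)).
Local Notation dg := (hb_deg (h := e)).
Local Notation ed a := (hb_deg (h := e) a).2.
Local Notation E := (dual_gen (e := e) true).
Local Notation H := (dual_gen (e := e) false).
Local Notation f := (cubic_coef (e := e)).

Definition quad_term (a : I) : weil_seq g := cmul (univ false (dv a)) (univ true (ev a)).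

Definition cubic_term (a b c : I) : weil_seq g :=
  cmul (univ true (dv a)) (cmul (univ true (dv b)) (univ true (dv c))).

Definition cubic_trunc (S : seq I) : weil_seq g :=
  \sum_(a <- S) quad_term a +
  \sum_(a <- S) \sum_(b <- S) \sum_(c <- S) f a b c *: cubic_term a b c.

Lemma quad_termE a :
  quad_term a = delta (dposn a + posn (dg a)) (weil_mul (H a) (weil_gen true (ev a))).
Proof.
rewrite /quad_term univ_dual (univ_delta true (hb_homog a)) cmul_delta.
by rewrite weil_mulE.
Qed.

Lemma cubic_termE a b c : cubic_term a b c =
  delta (dposn a + dposn b + dposn c) (weil_mul (E a) (weil_mul (E b) (E c))).
Proof.
have bcE : cmul (univ true (dv b)) (univ true (dv c)) =
    delta (dposn b + dposn c) (weil_mul (E b) (E c)).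
  by rewrite !univ_dual cmul_delta weil_mulE.
apply: (etrans (congr1 (cmul (univ true (dv a))) bcE)).
by rewrite univ_dual cmul_delta addnA weil_mulE.
Qed.

Lemma tens_ext_mul d (x : g) (u : colorExt g) : homog d x ->
  tens 1 (ext_mul (ext_gen x) u) = weil_mul (weil_gen true x) (tens 1 u).
Proof.
move=> hx; have := weil_genTl u hx (piece1 g 1 xpredT).
by rewrite (cf0r Heps) scale1r weil_mulE ext_mulE => ->.
Qed.

Lemma tens_ext3 d d' (x y z : g) : homog d x -> homog d' y ->
  tens 1 (ext3 x y z) =
  weil_mul (weil_gen true x) (weil_mul (weil_gen true y) (weil_gen true z)).
Proof.
move=> hx hy; rewrite /ext3 -ext_mulA (tens_ext_mul _ hx) (tens_ext_mul _ hy).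
by rewrite [weil_gen true z]weil_genT.
Qed.

Lemma quad_term_deg a : in_deg 0 (quad_term a).
Proof.
have := univ2_in_deg Heps false true (hb_dual_homog (e := e) a) (hb_homog a).
by rewrite addNr.
Qed.

Lemma cubic_term_What a b c : in_What (cubic_term a b c).
Proof.
exact: (in_deg_What (univ3_in_deg Heps true true true (hb_dual_homog a)
  (hb_dual_homog b) (hb_dual_homog c))).
Qed.

(** A nonzero coefficient forces the degrees of the letters to cancel; a zero term lies in every
    degree. *)
Lemma cubic_term_deg a b c : in_deg 0 (f a b c *: cubic_term a b c).
Proof.
have [f0|f0] := eqVneq (f a b c) 0.
  by move=> r; rewrite f0 scale0r; exact: span0.
apply: in_degZ; have := univ3_in_deg Heps true true true (hb_dual_homog (e := e) a)
  (hb_dual_homog (e := e) b) (hb_dual_homog (e := e) c).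
by rewrite -!opprD (cubic_coef_deg f0) oppr0.
Qed.

Lemma cubic_trunc_deg S : in_deg 0 (cubic_trunc S).
Proof.
apply: in_degD; first by apply: in_deg_sum => a _; exact: quad_term_deg.
apply: in_deg_sum => a _; apply: in_deg_sum => b _; apply: in_deg_sum => c _.
exact: cubic_term_deg.
Qed.

Lemma cubic_trunc_parity S : has_parity true (cubic_trunc S).
Proof.
move=> r; rewrite /cubic_trunc weil_seqDE !weil_seq_sumE.
rewrite -[X in weil_parity _ (X + _)]scale1r; apply: span_addZ; apply: span_sum => a _.
  rewrite quad_termE deltaE; case: eqP => _; last exact: span0.
  apply: span_base; exists 1%N, (dg a), (sym_gen (dv a)), (ext_gen (ev a)); split.
  - exact: (piece_gen (-1) (Q := xpredT) isT (hb_homog a)).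
  - by [].
  - by rewrite -weil_mulE /dual_gen weil_genF weil_genT (tens_split Heps).
rewrite weil_seq_sumE; apply: span_sum => b _.
rewrite weil_seq_sumE; apply: span_sum => c _.
rewrite weil_seqZE cubic_termE deltaE; apply: spanZ.
case: eqP => _; last exact: span0.
rewrite -(tens_ext3 _ (hb_dual_homog a) (hb_dual_homog b)).
apply: span_base.
exists 3%N, (- dg a + (- dg b + - dg c)), 1, (ext3 (dv a) (dv b) (dv c)); split.
- rewrite /ext3 -ext_mulA.
  apply: (piece_genM (Q := xpredT) isT (hb_dual_homog a)).
  apply: (piece_genM (Q := xpredT) isT (hb_dual_homog b)).
  exact: (piece_gen (-1) (Q := xpredT) isT (hb_dual_homog c)).
- by [].
- by [].
Qed.

Variables (W : colorExt g -> colorExt g -> C).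
Hypothesis HW : wedge_form W.
Variable phi : nat -> colorExt g.
Hypothesis Hphi : structure_tensor W phi.

(** The quadratic term of index [a] sits exactly in component [zdeg a], so components up to [M] see
    only the range [S]; for phi the range comes from [structure_tensorE]. *)
Lemma cubic_dirac_trunc M S n : uniq S -> (forall a, (a \in S) = (zdeg a <= M)%N) ->
  (n <= M)%N -> cubic_dirac e phi n = cubic_trunc S n.
Proof.
move=> uS SP nM; rewrite /cubic_dirac /cubic_trunc !weil_seqDE.
have -> : csum (fun a : I => tens_gen (dv a) (ev a)) n = (\sum_(a <- S) quad_term a) n.
  rewrite weil_seq_sumE /csum (fsbigE S) //=.
    under eq_bigl do rewrite mem_set //.
    by apply: eq_bigr => a _; rewrite (tens_genE Heps).
  move=> a _ aS; rewrite (tens_genE Heps) -/(quad_term a) quad_termE deltaE.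
  case: eqP => // nE; move: aS; rewrite SP; move: nM; rewrite nE /dposn /posn /zdeg /=.
  lia.
congr (_ + _).
rewrite (structure_tensorE Heps HW uS SP Hphi nM) linear_sum weil_seq_sumE.
apply: eq_bigr => a _; rewrite linear_sum weil_seq_sumE.
apply: eq_bigr => b _; rewrite linear_sum weil_seq_sumE.
apply: eq_bigr => c _; rewrite [LHS]tensZr weil_seqZE cubic_termE deltaE eq_sym.
case: ifP => _; last by rewrite scale0r scaler0.
rewrite (tens_ext3 _ (hb_dual_homog a) (hb_dual_homog b)).
by apply: eq_scale; rewrite /cubic_coef; exact: esym (mulrA _ _ _).
Qed.

Lemma cubic_dirac_deg : in_deg 0 (cubic_dirac e phi).
Proof.
move=> n; have [S uS SP] := hb_range e n.
by rewrite (cubic_dirac_trunc uS SP (leqnn n)); exact: cubic_trunc_deg.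
Qed.

Lemma cubic_dirac_parity : has_parity true (cubic_dirac e phi).
Proof.
move=> n; have [S uS SP] := hb_range e n.
by rewrite (cubic_dirac_trunc uS SP (leqnn n)); exact: cubic_trunc_parity.
Qed.

Variable D : weil_seq g -> weil_seq g.
Hypothesis HD : weil_differential e D.

Lemma diff0 : D 0 = 0.
Proof.
have z0 : in_What (0 : weil_seq g) by apply: (@in_deg_What _ _ _ _ 0) => r; exact: span0.
have z1 : -1 *: 0 + 0 = 0 :> weil_seq g by rewrite scaler0 addr0.
apply: (etrans (esym (congr1 D z1))); apply: (etrans (wd_linear HD (-1) z0 z0)).
by rewrite scaleN1r; exact: addNr.
Qed.

Lemma diffZ c u : in_What u -> D (c *: u) = c *: D u.
Proof.
move=> hu.
have z0 : in_What (0 : weil_seq g) by apply: (@in_deg_What _ _ _ _ 0) => r; exact: span0.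
apply: (etrans (congr1 D (esym (addr0 (c *: u))))).
apply: (etrans (wd_linear HD c hu z0)); rewrite diff0; exact: addr0.
Qed.

Lemma diffD d u v : in_deg d u -> in_deg d v -> D (u + v) = D u + D v.
Proof.
move=> hu hv; have := wd_linear HD 1 (in_deg_What hu) (in_deg_What hv).
by rewrite !scale1r.
Qed.

Lemma diff_sum d (J : Type) (s : seq J) (F : J -> weil_seq g) :
  (forall i, in_deg d (F i)) -> D (\sum_(i <- s) F i) = \sum_(i <- s) D (F i).
Proof.
move=> dF; elim: s => [|i s IHs]; first by rewrite !big_nil diff0.
by rewrite !big_cons (diffD (dF i)) ?IHs //; apply: in_deg_sum => j _.
Qed.

Lemma diff_trunc S : D (cubic_trunc S) = \sum_(a <- S) D (quad_term a) +
  \sum_(a <- S) \sum_(b <- S) \sum_(c <- S) f a b c *: D (cubic_term a b c).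
Proof.
have c3 a b c := @cubic_term_deg a b c.
have c2 a b : in_deg 0 (\sum_(c <- S) f a b c *: cubic_term a b c).
  by apply: in_deg_sum => c _; exact: c3.
have c1 a : in_deg 0 (\sum_(b <- S) \sum_(c <- S) f a b c *: cubic_term a b c).
  by apply: in_deg_sum => b _; exact: c2.
rewrite (@diffD 0); first last.
- by apply: in_deg_sum => a _; exact: c1.
- by apply: in_deg_sum => a _; exact: quad_term_deg.
rewrite (diff_sum _ quad_term_deg); congr (_ + _).
rewrite (diff_sum _ c1); apply: eq_bigr => a _.
rewrite (diff_sum _ (c2 a)); apply: eq_bigr => b _.
rewrite (diff_sum _ (c3 a b)); apply: eq_bigr => c _.
exact/diffZ/cubic_term_What.
Qed.

(** Continuity is available within one bidegree, so it is applied to the difference of the two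
    elements, which has bidegree 0 and no component below [N]. *)
Lemma diff_cubic_dirac r : exists M, forall M' S, (M <= M')%N -> uniq S ->
  (forall a, (a \in S) = (zdeg a <= M')%N) ->
  D (cubic_dirac e phi) r = D (cubic_trunc S) r.
Proof.
have [N contN] := wd_continuous HD 0 r.
exists N => M' S NM uS SP.
pose v := cubic_dirac e phi - cubic_trunc S.
have dv0 : in_deg 0 v.
  apply: in_degD; first exact: cubic_dirac_deg.
  by rewrite -scaleN1r; apply/in_degZ/cubic_trunc_deg.
have -> : cubic_dirac e phi = v + cubic_trunc S by rewrite subrK.
rewrite (diffD dv0 (cubic_trunc_deg S)) weil_seqDE.
rewrite (contN v dv0 _ r (leqnn r)) ?add0r // => n nN.
rewrite /v weil_seqDE weil_seqNE (cubic_dirac_trunc uS SP) ?subrr //.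
exact: leq_trans (ltnW nN) NM.
Qed.

End Truncation.

(** * The differential on single components of quadratic and cubic terms *)

Section Components.
Variables (R : realType) (Gam : zmodType) (eps : Gam -> Gam -> R[i]).
Hypothesis Heps : commutation_factor eps.
Variable g : quadColorLie eps.
Local Notation br := (@qc_br R Gam eps g).
Local Notation B := (@qc_form R Gam eps g).
Variable e : homogBasis g.
Local Notation I := (hb_idx e).
Local Notation ev := (hb_vec (h := e)).
Local Notation dv := (hb_dual (h := e)).
Local Notation dg := (hb_deg (h := e)).
Local Notation ed a := (hb_deg (h := e) a).2.
Local Notation E := (dual_gen (e := e) true).
Local Notation H := (dual_gen (e := e) false).
Local Notation q := (color (e := e)).
Local Notation "x ** y" := (@weil_mul R Gam eps g x y) (at level 40, left associativity).

Let mulZl := amulZl (@weil_mul_linl R Gam eps g).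
Let mulZr := amulZr (@weil_mul_linr R Gam eps g).
Let mul_suml := amul_suml (@weil_mul_linl R Gam eps g).
Let mul_sumr := amul_sumr (@weil_mul_linr R Gam eps g).

Lemma weil_mul0 u : u ** 0 = 0.
Proof. by rewrite -weil_mulE mulr0. Qed.

Lemma weil_0mul u : 0 ** u = 0.
Proof. by rewrite -weil_mulE mul0r. Qed.

Lemma weil_mulDl u v w : (u + v) ** w = u ** w + v ** w.
Proof. by rewrite -!weil_mulE mulrDl. Qed.

Lemma weil_mulDr u v w : w ** (u + v) = w ** u + w ** v.
Proof. by rewrite -!weil_mulE mulrDr. Qed.

Variable D : weil_seq g -> weil_seq g.
Hypothesis HD : weil_differential e D.

Definition bracket_sum (S : seq I) p p' (x : g) (n : nat) : Weil g :=
  \sum_(b <- S) \sum_(c <- S)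
    (if (dposn b + dposn c == n)%N
     then dual_sign b c * B x (br (ev b) (ev c)) else 0)
      *: (dual_gen p b ** dual_gen p' c).

Lemma conn_bracket_sum M (S : seq I) p p' d (x : g) n :
  uniq S -> (forall a, (a \in S) = (zdeg a <= M)%N) -> homog d x ->
  n%:Z <= M%:Z -> n%:Z - d.1 <= M%:Z ->
  conn_bracket e (univ p) (univ p') x n = - (2^-1 *: bracket_sum S p p' x n).
Proof.
move=> uS SP hx nM ndM; rewrite (conn_bracketE p p' uS SP hx nM ndM).
do 2!apply: congr1; apply: eq_bigr => b _; apply: eq_bigr => c _.
by rewrite weil_mulE.
Qed.

Lemma diffF_comp M (S : seq I) d (x : g) n :
  uniq S -> (forall a, (a \in S) = (zdeg a <= M)%N) -> homog d x ->
  n%:Z <= M%:Z -> n%:Z - d.1 <= M%:Z ->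
  D (univ false x) n = 2^-1 *: bracket_sum S true false x n.
Proof.
move=> uS SP hx nM ndM; rewrite {1}univF (wd_F HD) -univF -univT weil_seqNE.
by rewrite (conn_bracket_sum _ _ uS SP hx nM ndM) opprK.
Qed.

Lemma diffA_comp M (S : seq I) d (x : g) n :
  uniq S -> (forall a, (a \in S) = (zdeg a <= M)%N) -> homog d x ->
  n%:Z <= M%:Z -> n%:Z - d.1 <= M%:Z ->
  D (univ true x) n = univ false x n + 4%:R^-1 *: bracket_sum S true true x n.
Proof.
move=> uS SP hx nM ndM; rewrite {1}univT (wd_A HD) -univF -univT.
rewrite weil_seqDE weil_seqNE weil_seqZE (conn_bracket_sum _ _ uS SP hx nM ndM).
move: (univ false x n) (bracket_sum _ _ _ _ _) => u v.
rewrite scalerN opprK scalerA; apply: congr1; apply: eq_scale.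
by rewrite -invfM -natrM.
Qed.

(** dW(A) is even: its F part commutes up to color, and in its A A part the two minus signs cancel.
    The color factors of the two letters combine to [q b a] since a nonzero coefficient forces
    [dg a = dg p + dg l]. *)
Lemma diffA_comm a b n :
  E b ** D (univ true (dv a)) n = q b a *: (D (univ true (dv a)) n ** E b).
Proof.
have [S uS SP] := hb_range e (n + zdeg a).
have nM : n%:Z <= (n + zdeg a)%:Z by lia.
have ndM : n%:Z - (- dg a).1 <= (n + zdeg a)%:Z by rewrite /= /zdeg; lia.
rewrite (diffA_comp uS SP (hb_dual_homog a) nM ndM).
rewrite weil_mulDr weil_mulDl scalerDr; congr (_ + _).
  rewrite univ_dual deltaE; case: eqP => _; first exact: (dual_ext_sym_comm Heps).
  by rewrite weil_mul0 weil_0mul scaler0.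
rewrite mulZr mulZl scalerA [q b a * _]mulrC -scalerA; apply: congr1.
rewrite mul_sumr mul_suml scaler_sumr; apply: eq_bigr => p _.
rewrite mul_sumr mul_suml scaler_sumr; apply: eq_bigr => l _.
rewrite mulZr mulZl scalerA.
rewrite weil_mulA (dual_ext_comm Heps) mulZl -weil_mulA (dual_ext_comm Heps) mulZr.
rewrite weil_mulA !scalerA.
apply: eq_scale; case: ifP => _; last by rewrite mulr0 !mul0r.
have [B0|B0] := eqVneq (B (dv a) (br (ev p) (ev l))) 0.
  by rewrite B0 !(mulr0, mul0r).
have dE : dg a = dg p + dg l.
  apply/esym/eqP; rewrite -subr_eq0 addrC; apply: contraNT B0 => nd.
  by rewrite (form_deg (hb_dual_homog a) (homog_br (hb_homog p) (hb_homog l)) nd).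
by rewrite /color dE /= (cf_Dr Heps); ring.
Qed.

Lemma quad_term_diff a r : D (quad_term a) r =
  (if (posn (dg a) <= r)%N
   then D (univ false (dv a)) (r - posn (dg a))%N ** weil_gen true (ev a) else 0) +
  (if (dposn a <= r)%N
   then H a ** D (univ true (ev a)) (r - dposn a)%N else 0).
Proof.
have L := wd_leibniz HD (in_deg_What (univ_in_deg Heps false (hb_dual_homog a)))
  (in_deg_What (univ_in_deg Heps true (hb_homog a)))
  (univ_parity false (hb_dual_homog a)).
rewrite /quad_term L weil_seqDE weil_seqZE scale1r.
congr (_ + _).
  by rewrite (univ_delta true (hb_homog a)) cmul_deltar weil_mulE.
by rewrite univ_dual cmul_deltal weil_mulE.
Qed.

(** The other letters of a word use up [m] of the index [r]. The test guards the subtraction on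
    [nat], which would otherwise return component 0 for [m] beyond [r]. *)
Definition diffA_part r a m : Weil g :=
  if (m <= r)%N then D (univ true (dv a)) (r - m)%N else 0.

Lemma diffA_part_comm r a b m :
  E b ** diffA_part r a m = q b a *: (diffA_part r a m ** E b).
Proof.
rewrite /diffA_part; case: ifP => _; first exact: diffA_comm.
by rewrite weil_mul0 weil_0mul scaler0.
Qed.

Lemma cubic_term_diff a b c r : D (cubic_term a b c) r =
  diffA_part r a (dposn b + dposn c)%N ** (E b ** E c) -
  E a ** (diffA_part r b (dposn a + dposn c)%N ** E c) +
  E a ** (E b ** diffA_part r c (dposn a + dposn b)%N).
Proof.
have hA x := univ_in_deg Heps true (hb_dual_homog (e := e) x).
have pA x := univ_parity true (hb_dual_homog (e := e) x).
have L1 := wd_leibniz HD (in_deg_What (hA a)) (in_deg_What (univ2_in_deg Heps true true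
  (hb_dual_homog b) (hb_dual_homog c))) (pA a).
have L2 := wd_leibniz HD (in_deg_What (hA b)) (in_deg_What (hA c)) (pA b).
apply: (etrans (congr1 (fun u : weil_seq g => u r) L1)).
rewrite weil_seqDE weil_seqZE scaleN1r -addrA; congr (_ + _).
  have -> : cmul (univ true (dv b)) (univ true (dv c)) =
      delta (dposn b + dposn c) (E b ** E c).
    by rewrite !univ_dual cmul_delta weil_mulE.
  rewrite cmul_deltar weil_mulE /diffA_part.
  by case: ifP => _ //; rewrite weil_0mul.
have C1 n : cmul (D (univ true (dv b))) (univ true (dv c)) n =
    if (dposn c <= n)%N then D (univ true (dv b)) (n - dposn c)%N ** E c else 0.
  by rewrite (univ_dual true c) cmul_deltar weil_mulE.
have C2 n : cmul (univ true (dv b)) (D (univ true (dv c))) n =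
    if (dposn b <= n)%N then E b ** D (univ true (dv c)) (n - dposn b)%N else 0.
  by rewrite (univ_dual true b) cmul_deltal weil_mulE.
have C3 n := etrans (congr1 (fun u : weil_seq g => u n) L2)
  (congr2 +%R (C1 n) (etrans (scaleN1r _) (congr1 -%R (C2 n)))).
rewrite univ_dual cmul_deltal weil_mulE [D (cmul _ _) _]C3 /diffA_part.
(* The nested products test the index twice, first for [a] and then for the remainder; the two tests
   merge into the single guard of [diffA_part]. *)
rewrite !subnDA; case: (leqP (dposn a) r) => ar; last first.
  have le_false k : (dposn a + k <= r)%N = false by apply/negbTE; rewrite -ltnNge ltn_addr.
  by rewrite !le_false weil_0mul !weil_mul0 oppr0 addr0.
rewrite -!(leq_subRL _ ar) weil_mulDr opprD; apply: congr2.
  by case: ifP; rewrite // weil_0mul weil_mul0.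
rewrite -scaleN1r -[- (if _ then _ else _)]scaleN1r mulZr scalerA mulrNN mulr1 scale1r.
by case: ifP; rewrite // !weil_mul0.
Qed.

End Components.

(** * Summation over the range and cancellation *)

Section FinalSums.
Variables (R : realType) (Gam : zmodType) (eps : Gam -> Gam -> R[i]).
Hypothesis Heps : commutation_factor eps.
Variable g : quadColorLie eps.
Local Notation C := (R[i]).
Local Notation br := (@qc_br R Gam eps g).
Local Notation B := (@qc_form R Gam eps g).
Variable e : homogBasis g.
Local Notation I := (hb_idx e).
Local Notation ev := (hb_vec (h := e)).
Local Notation dv := (hb_dual (h := e)).
Local Notation dg := (hb_deg (h := e)).
Local Notation ed a := (hb_deg (h := e) a).2.
Local Notation sg a := (eps (ed a) (ed a)).
Local Notation E := (dual_gen (e := e) true).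
Local Notation H := (dual_gen (e := e) false).
Local Notation q := (color (e := e)).
Local Notation t := (triple (e := e)).
Local Notation f := (cubic_coef (e := e)).
Local Notation "x ** y" := (@weil_mul R Gam eps g x y) (at level 40, left associativity).

Let mulZl := amulZl (@weil_mul_linl R Gam eps g).
Let mulZr := amulZr (@weil_mul_linr R Gam eps g).
Let mul_suml := amul_suml (@weil_mul_linl R Gam eps g).
Let mul_sumr := amul_sumr (@weil_mul_linr R Gam eps g).

Variable D : weil_seq g -> weil_seq g.
Hypothesis HD : weil_differential e D.

Variables (M r : nat) (S : seq I).
Hypotheses (uS : uniq S) (SP : forall a, (a \in S) = (zdeg a <= M)%N) (rM : (r <= M)%N).

Definition cubic_filter (a b c : I) : bool := (dposn a + dposn b + dposn c == r)%N.
Local Notation P := cubic_filter.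

Definition mixed_sum : Weil g :=
  \sum_(a <- S) \sum_(b <- S) \sum_(c <- S)
    (if P a b c then color_sign q b c * t a b c else 0) *: (H a ** E b ** E c).

Lemma dual_signE b c : dual_sign b c = color_sign q b c.
Proof. by []. Qed.

Lemma if_mulr (b : bool) (x y : C) : (if b then x * y else 0) = (if b then x else 0) * y.
Proof. by case: b; rewrite // mul0r. Qed.

Lemma mul_weil_gen_sum p (s : seq I) (c : I -> C) (x : I -> g) (X : Weil g) :
  X ** weil_gen p (\sum_(a <- s) c a *: x a) =
  \sum_(a <- s) c a *: (X ** weil_gen p (x a)).
Proof.
have -> : weil_gen p (\sum_(a <- s) c a *: x a) = \sum_(a <- s) c a *: weil_gen p (x a).
  apply: (etrans (linear_sum _ _ _ _)); apply: eq_bigr => a _; exact: linearZ.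
by rewrite mul_sumr; apply: eq_bigr => a _; exact: mulZr.
Qed.

Lemma mul_weil_genZ p c (x : g) (X : Weil g) :
  X ** weil_gen p (c *: x) = c *: (X ** weil_gen p x).
Proof. by rewrite -mulZr; apply: congr1; exact: linearZ. Qed.

(* The invariance of sum_a e^a (x) e_a under exchanging a basis with its dual. *)
Lemma casimir_swap (k : nat) d (z : g) (c : C) (X : Weil g) : homog d z ->
  \sum_(a <- S) (if (posn (dg a) + k == r)%N then c * B (dv a) z else 0) *:
    (X ** weil_gen true (ev a)) =
  \sum_(a <- S) (if (dposn a + k == r)%N then q a a * (c * B (ev a) z) else 0) *:
    (X ** E a).
Proof.
move=> hz.
pose c' := if (posn d + k == r)%N then c else 0.
transitivity (c' *: (X ** weil_gen true (\sum_(a <- S) B (dv a) z *: ev a))).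
  rewrite mul_weil_gen_sum scaler_sumr; apply: eq_bigr => a _.
  rewrite scalerA; apply: eq_scale.
  have [B0|B0] := eqVneq (B (dv a) z) 0; first by rewrite B0 !mulr0 if_same.
  have -> : dg a = d.
    apply/esym/eqP; rewrite -subr_eq0 addrC; apply: contraNT B0 => nd.
    by rewrite (form_deg (hb_dual_homog a) hz nd).
  by rewrite if_mulr.
rewrite (vec_expand Heps uS SP hz).
have -> : (if (absz d.1 <= M)%N then eps d.2 d.2 *: z else 0) =
    eps d.2 d.2 *: \sum_(a <- S) B (ev a) z *: dv a.
  by rewrite (dual_expand uS SP hz); case: ifP => _; rewrite ?scaler0.
rewrite mul_weil_genZ mul_weil_gen_sum scalerA scaler_sumr; apply: eq_bigr => a _.
rewrite scalerA; apply: eq_scale.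
have [B0|B0] := eqVneq (B (ev a) z) 0; first by rewrite B0 !mulr0 if_same.
have aE : dg a = - d.
  apply/eqP; rewrite -addr_eq0; apply: contraNT B0 => nd.
  by rewrite (form_deg (hb_homog a) hz nd).
rewrite /dposn /color aE opprK /c' /= (cfNl Heps) (cfNr Heps) invrK.
by case: ifP => _; [ring | rewrite !mul0r].
Qed.

(** The last letter involves [ev a] instead of a dual vector: [casimir_swap] corrects this at the
    cost of [q a a], precisely the factor that [sum_mixed] expects before it brings the word into
    the order F A A. *)
Lemma quad_term_diff1 :
  \sum_(a <- S) (if (posn (dg a) <= r)%N
    then D (univ false (dv a)) (r - posn (dg a))%N ** weil_gen true (ev a) else 0) =
  - (2^-1 *: mixed_sum).
Proof.
have -> : \sum_(a <- S) (if (posn (dg a) <= r)%N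
    then D (univ false (dv a)) (r - posn (dg a))%N ** weil_gen true (ev a) else 0) =
  2^-1 *: \sum_(b <- S) \sum_(c <- S) \sum_(a <- S)
    (if (posn (dg a) + (dposn b + dposn c) == r)%N
     then dual_sign b c * B (dv a) (br (ev b) (ev c)) else 0) *:
     (E b ** H c ** weil_gen true (ev a)).
  transitivity (2^-1 *: \sum_(a <- S) \sum_(b <- S) \sum_(c <- S)
    (if (posn (dg a) + (dposn b + dposn c) == r)%N
     then dual_sign b c * B (dv a) (br (ev b) (ev c)) else 0) *:
     (E b ** H c ** weil_gen true (ev a))); last first.
    apply: scale_congr.
    exact: sum_inner3.
  rewrite scaler_sumr; apply: eq_bigr => a _; case: leqP => ar; last first.
    rewrite big1 ?scaler0 // => b _; rewrite big1 // => c _; case: eqP => [rE|_].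
      by move: ar; rewrite -rE ltnNge leq_addr.
    by rewrite scale0r.
  rewrite (diffF_comp HD uS SP (hb_dual_homog a)); first last.
  - by move: ar rM; rewrite /posn /=; lia.
  - by move: rM; lia.
  rewrite mulZl mul_suml; apply: scale_congr; apply: eq_bigr => b _.
  rewrite mul_suml; apply: eq_bigr => c _; rewrite mulZl; apply: eq_scale.
  by rewrite -[in RHS](subnKC ar) eqn_add2l.
rewrite -scalerN; apply: scale_congr.
rewrite /mixed_sum.
rewrite -(sum_mixed (@weil_mulA R Gam eps g) (@weil_mul_linl R Gam eps g)
  (@weil_mul_linr R Gam eps g) S (color_skew Heps (e := e)) (dual_ext_comm Heps (e := e))
  (dual_ext_sym_comm Heps (e := e)) (t := t)); first last.
- by move=> a b c; exact: triple_rot.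
- by move=> a b c; rewrite /P addnC addnA.
rewrite [RHS]sum_inner3; apply: eq_bigr => b _; apply: eq_bigr => c _.
apply: (etrans (casimir_swap _ _ _ (homog_br (hb_homog b) (hb_homog c)))).
by apply: eq_bigr => a _; apply: eq_scale; rewrite addnA.
Qed.

(** Here the F letter already stands first and the coefficient of the bracket is already [t a b c],
    so the words need no sorting. *)
Lemma quad_term_diff2 :
  \sum_(a <- S) (if (dposn a <= r)%N
    then H a ** D (univ true (ev a)) (r - dposn a)%N else 0) =
  \sum_(a <- S) (if (dposn a + posn (dg a) == r)%N
    then H a ** weil_gen false (ev a) else 0) + 4%:R^-1 *: mixed_sum.
Proof.
rewrite scaler_sumr -big_split; apply: eq_bigr => a _ /=.
case: leqP => ar; last first.
  rewrite ifN ?add0r; last first.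
    by apply/eqP => rE; move: ar; rewrite -rE ltnNge leq_addr.
  rewrite big1 ?scaler0 // => b _; rewrite big1 // => c _.
  rewrite /P; case: eqP => [rE|_]; last by rewrite scale0r.
  by move: ar; rewrite -rE ltnNge -addnA leq_addr.
rewrite (diffA_comp HD uS SP (hb_homog a)); first last.
- by move: ar rM; rewrite /dposn /posn /=; lia.
- by move: rM; lia.
rewrite weil_mulDr; apply: congr2.
  rewrite (univ_delta false (hb_homog a)) deltaE.
  rewrite -[in RHS](subnKC ar) eqn_add2l eq_sym.
  by case: ifP => _; rewrite ?weil_mul0.
apply: (etrans (mulZr _ _ _)); apply: scale_congr.
rewrite mul_sumr; apply: eq_bigr => b _.
rewrite mul_sumr; apply: eq_bigr => c _.
apply: (etrans (mulZr _ _ _)); rewrite weil_mulA; apply: eq_scale.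
by rewrite /P -addnA -[in RHS](subnKC ar) eqn_add2l.
Qed.

Definition quartic (b c p l : I) : C := B (ev b) (br (ev c) (br (ev p) (ev l))).

Lemma quartic_jacobi b c p l :
  quartic b c p l = - (q c l * q p l * quartic b l c p) + q c p * quartic b p c l.
Proof.
rewrite /quartic (qc_br_jacobi (ev l) (hb_homog c) (hb_homog p)).
rewrite (qc_br_skew (homog_br (hb_homog c) (hb_homog p)) (hb_homog l)).
rewrite -scaleNr linearD /= !formZr mulNr /=.
by rewrite (cf_Dl Heps).
Qed.

Definition quartic_filter (b c p l : I) : bool :=
  (dposn p + dposn l + (dposn b + dposn c) == r)%N.

(** Contracting [a] rebuilds [br (ev b) (ev c)], and invariance moves [ev c] to the other side. The
    filter matters: with [r <= M] and total degree 0 it keeps the Z-degree of the inner bracket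
    within the range. *)
Lemma quartic_sum b c p l : quartic_filter b c p l ->
  \sum_(a <- S) t a b c * B (dv a) (br (ev p) (ev l)) = quartic b c p l.
Proof.
move=> Q; have hz := homog_br (hb_homog b) (hb_homog c).
have hy := homog_br (hb_homog p) (hb_homog l).
rewrite -form_suml (dual_expand uS SP hz) /quartic -[RHS]qc_form_inv.
case: ifPn => // dM; have [d0|nd] := eqVneq (dg b + dg c + (dg p + dg l)) 0; last first.
  rewrite (form_deg hz hy nd).
  by have := form_suml (Nil nat) (fun=> 0) (fun=> 0 : g) (br (ev p) (ev l));
    rewrite !big_nil.
move: dM Q (congr1 fst d0) rM; rewrite /quartic_filter /dposn /posn /=; lia.
Qed.

Lemma cubic_sum_diff :
  \sum_(a <- S) \sum_(b <- S) \sum_(c <- S) f a b c *: D (cubic_term a b c) r =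
  4%:R^-1 *: mixed_sum.
Proof.
apply: (etrans (sum_ext3 S (fun a b c => scale_congr (f a b c)
  (cubic_term_diff Heps HD a b c r)))).
apply: (etrans (sum_sym3 (@weil_mulA R Gam eps g) (@weil_mul_linl R Gam eps g)
  (@weil_mul_linr R Gam eps g) S (@dposn R Gam eps g e)
  (fun b a m => diffA_part_comm Heps HD r a b m)
  (@cubic_coef_skew R Gam eps Heps g e) (@cubic_coef_rot R Gam eps Heps g e))).
pose G a b c p l : C := f a b c * (4%:R^-1 * (if quartic_filter b c p l
  then dual_sign p l * B (dv a) (br (ev p) (ev l)) else 0)).
pose X b c p l := E p ** E l ** (E b ** E c).
have termE a b c : f a b c *: (diffA_part D r a (dposn b + dposn c)%N ** (E b ** E c)) =
    (12%:R^-1 * (if P a b c then color_sign q b c * t a b c else 0)) *: (H a ** E b ** E c)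
    + \sum_(p <- S) \sum_(l <- S) G a b c p l *: X b c p l.
  (* A nonzero coefficient gives the degree relation that bounds the positive Z-degree of [ev a], as
     [diffA_comp] requires. *)
  have [f0|f0] := eqVneq (f a b c) 0.
    rewrite f0 scale0r; have -> : color_sign q b c * t a b c = 0.
      move: f0 => /eqP; rewrite /cubic_coef mulf_eq0 invr_eq0 pnatr_eq0 /=.
      by rewrite dual_signE => /eqP.
    rewrite if_same mulr0 scale0r add0r big1 // => p _; rewrite big1 // => l _.
    by rewrite /G f0 mul0r scale0r.
  have d0 := cubic_coef_deg f0.
  have PE : P a b c = (dposn a + (dposn b + dposn c) == r)%N by rewrite /P addnA.
  rewrite /diffA_part; case: leqP => bcr; last first.
    rewrite weil_0mul scaler0 PE ifN; last first.
      by apply/eqP => rE; move: bcr; rewrite -rE ltnNge leq_addl.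
    rewrite mulr0 scale0r add0r big1 // => p _; rewrite big1 // => l _.
    rewrite /G ifN ?mulr0 ?scale0r //; apply/eqP => rE.
    by move: bcr; rewrite -rE ltnNge leq_addl.
  rewrite (diffA_comp HD uS SP (hb_dual_homog a)); first last.
  - by move: bcr rM (congr1 fst d0); rewrite /dposn /posn /=; lia.
  - by move: rM; lia.
  rewrite weil_mulDl scalerDr; apply: congr2.
    rewrite univ_dual deltaE PE -[in RHS](subnK bcr) eqn_add2r eq_sym.
    case: ifP => _; last by rewrite weil_0mul mulr0 scaler0 scale0r.
    by rewrite weil_mulA; apply: eq_scale.
  apply: (etrans (scale_congr _ (mulZl _ _ _))).
  rewrite scalerA mul_suml scaler_sumr; apply: eq_bigr => p _.
  rewrite mul_suml scaler_sumr; apply: eq_bigr => l _.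
  apply: (etrans (scale_congr _ (mulZl _ _ _))).
  rewrite scalerA; apply: eq_scale; rewrite /G mulrA; apply: congr1.
  by rewrite /quartic_filter -[in RHS](subnK bcr) eqn_add2r.
apply: (etrans (scale_congr _ (sum_ext3 S termE))).
apply: (etrans (scale_congr _ (sum_split3 _ _ _))).
have quartic0 : \sum_(a <- S) \sum_(b <- S) \sum_(c <- S)
    \sum_(p <- S) \sum_(l <- S) G a b c p l *: X b c p l = 0.
  (* The word no longer involves [a], so this index is summed innermost and contracted by
     [quartic_sum]. *)
  apply: (etrans (sum_inner5 _ _ _)).
  transitivity ((12%:R^-1 * 4%:R^-1) *: \sum_(b <- S) \sum_(c <- S) \sum_(p <- S)
      \sum_(l <- S) (if quartic_filter b c p l
      then color_sign q b c * color_sign q p l * quartic b c p l else 0) *: X b c p l).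
    rewrite scaler_sumr; apply: eq_bigr => b _.
    rewrite scaler_sumr; apply: eq_bigr => c _.
    rewrite scaler_sumr; apply: eq_bigr => p _.
    rewrite scaler_sumr; apply: eq_bigr => l _.
    rewrite scalerA; apply: eq_scale; rewrite /G.
    case: ifP => [Q|_]; last by rewrite [RHS]mulr0 big1 // => a _; rewrite !mulr0.
    rewrite -(quartic_sum Q) !mulr_sumr; apply: eq_bigr => a _.
    by rewrite /cubic_coef !dual_signE; ring.
  apply: (etrans (scale_congr _ _)); first
    apply: (sum_jacobi (@weil_mulA R Gam eps g) (@weil_mul_linl R Gam eps g)
    (@weil_mul_linr R Gam eps g) S (color_skew Heps (e := e)) (dual_ext_comm Heps (e := e))).
  - by rewrite pnatr_eq0.
  - by move=> b c p l; rewrite /quartic_filter; congr (_ == _); lia.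
  - by move=> b c p l; rewrite /quartic_filter; congr (_ == _); lia.
  - exact: quartic_jacobi.
  exact: scaler0.
apply: (etrans (scale_congr _ (congr2 +%R (scale_sum3 _ _ _ _) quartic0))).
rewrite addr0 scalerA; apply: eq_scale.
have -> : 12%:R = 3%:R * 4%:R :> C by rewrite -natrM.
by rewrite invfM mulrA mulfV ?mul1r // pnatr_eq0.
Qed.

(** On nonzero terms the sign and the exchange of arguments in [B] cancel; summing over the second
    index then rebuilds [ev a] from the dual vectors. The terms match the F F part left by
    [quad_term_diff2]. *)
Lemma char_form_comp : char_form e r =
  \sum_(a <- S) (if (dposn a + posn (dg a) == r)%N
    then H a ** weil_gen false (ev a) else 0).
Proof.
have FE a : Funiv (dv a) = delta (dposn a) (H a) by rewrite -univF univ_dual.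
rewrite /char_form (csum_pairE uS SP) => [|[a b]] /=; last first.
  rewrite weil_seqZE !FE cmul_delta deltaE => nz.
  have rE : r = (dposn a + dposn b)%N.
    by apply/eqP; apply: contraNT nz => /negPf ->; rewrite scaler0.
  have d0 : dg a + dg b = 0.
    apply/eqP; apply: contraNT nz => nd.
    by rewrite (form_deg (hb_homog a) (hb_homog b) nd) mulr0 scale0r.
  by move: rM (congr1 fst d0); rewrite rE /zdeg /dposn /posn /=; lia.
apply: eq_big_seq => a aS.
transitivity (\sum_(b <- S) B (ev b) (ev a) *:
    (if (dposn a + posn (dg a) == r)%N then H a ** H b else 0)).
  apply: eq_bigr => b _; rewrite weil_seqZE !FE cmul_delta deltaE weil_mulE.
  have [B0|B0] := eqVneq (B (ev b) (ev a)) 0.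
    rewrite (qc_form_sym (hb_homog a) (hb_homog b)) B0 !mulr0 !scale0r //.
  have bE : dg b = - dg a.
    apply/eqP; rewrite -addr_eq0; apply: contraNT B0 => nd.
    by rewrite (form_deg (hb_homog b) (hb_homog a) nd).
  rewrite {2}/dposn bE opprK eq_sym; apply: eq_scale.
  rewrite (qc_form_sym (hb_homog a) (hb_homog b)) /dual_sign bE /=.
  rewrite !(cfNl Heps, cfNr Heps) invrK -!(cf_inv Heps).
  transitivity ((sg a * sg a) * (sg a * sg a) * B (ev b) (ev a)); first by ring.
  by rewrite (hb_sgn2 Heps) !mul1r.
case: ifP => _; last by rewrite big1 // => b _; rewrite scaler0.
rewrite -mul_weil_gen_sum (dual_expand uS SP (hb_homog a)).
by rewrite -/(zdeg a) -SP aS.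
Qed.

Lemma cubic_trunc_diff : D (cubic_trunc S) r = char_form e r.
Proof.
apply: (etrans (congr1 (fun u : weil_seq g => u r) (diff_trunc Heps HD S))).
rewrite weil_seqDE weil_seq_sumE.
have -> : (\sum_(a <- S) \sum_(b <- S) \sum_(c <- S) f a b c *: D (cubic_term a b c)) r =
    \sum_(a <- S) \sum_(b <- S) \sum_(c <- S) f a b c *: D (cubic_term a b c) r.
  rewrite weil_seq_sumE; apply: eq_bigr => a _.
  rewrite weil_seq_sumE; apply: eq_bigr => b _.
  by rewrite weil_seq_sumE; apply: eq_bigr => c _.
rewrite cubic_sum_diff (eq_bigr _ (fun a _ => quad_term_diff Heps HD a r)) big_split /=.
rewrite quad_term_diff1 quad_term_diff2 char_form_comp.
move: mixed_sum (\sum_(a <- S) _) => h v.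
have -> : 2%:R^-1 *: h = 4%:R^-1 *: h + 4%:R^-1 *: h.
  by rewrite -scalerDl; apply: eq_scale; field.
move: (4%:R^-1 *: h) => k.
by rewrite -addrA -[v + k + k]addrA [v + _]addrC addrA addNr add0r.
Qed.

End FinalSums.

Theorem proposition61 (R : realType) (Gam : zmodType)
  (eps : Gam -> Gam -> R[i]) (Heps : commutation_factor eps)
  (g : quadColorLie eps) (e : homogBasis g)
  (W : colorExt g -> colorExt g -> R[i]) (HW : wedge_form W)
  (phi : nat -> colorExt g) (Hphi : structure_tensor W phi)
  (dW : weil_seq g -> weil_seq g) (HdW : weil_differential e dW) :
  chern_simons dW (char_form e) (cubic_dirac e phi).
Proof.
split.
- exact: (in_deg_What (cubic_dirac_deg Heps e HW Hphi)).
- exact: (cubic_dirac_parity Heps e HW Hphi).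
apply/funext => r; have [N NP] := diff_cubic_dirac Heps HW Hphi HdW r.
(* [N] serves the continuity argument, and [r] the evaluation of component [r] on the range. *)
have [S uS SP] := hb_range e (maxn N r).
apply: (etrans (NP _ _ (leq_maxl N r) uS SP)).
exact: (cubic_trunc_diff Heps HdW uS SP (leq_maxr N r)).
Qed.
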